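(* Let $\mathcal{H}$ be a Hilbert $C^*$-module over a unital $C^*$-algebra $\mathcal{A}$, let $\{\mathcal{H}_j\}_{j\in J}$ be a family of closed submodules of $\mathcal{H}$, and let $C,C'\in GL^+(\mathcal{H})$. Let $\{\Lambda_j\in End_{\mathcal{A}}^*(\mathcal{H},\mathcal{H}_j):j\in J\}$ be a $(C,C')$-controlled g-frame for $\mathcal{H}$ with respect to $\{\mathcal{H}_j\}_{j\in J}$, and let $\{\Gamma_j\in End_{\mathcal{A}}^*(\mathcal{H},\mathcal{H}_j):j\in J\}$ be a $(C,C')$-controlled g-Bessel sequence for $\mathcal{H}$ with respect to $\{\mathcal{H}_j\}_{j\in J}$. Assume that $C$ and $C'$ commute with each other and, for each $j\in J$, commute with $\Lambda_j^*\Lambda_j$ and with $\Gamma_j^*\Gamma_j$. If the operator $L_{(C,C')}:\mathcal{H}\to\mathcal{H}$ defined by $L_{(C,C')}(f)=\sum_{j\in J}C'\Gamma_j^*\Lambda_jCf$ is surjective, then $\{\Gamma_j:j\in J\}$ is also a $(C,C')$-controlled g-frame for $\mathcal{H}$ with respect to $\{\mathcal{H}_j\}_{j\in J}$.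
   Context: $\mathcal{A}$ is a unital $C^*$-algebra, and $\mathcal{H}$ is a (left) Hilbert $\mathcal{A}$-module with $\mathcal{A}$-valued inner product $\langle\cdot,\cdot\rangle$ ($\mathcal{A}$-linear in the first variable) and norm $\|f\|=\|\langle f,f\rangle\|^{1/2}$. $J$ is any index set. $End_{\mathcal{A}}^*(\mathcal{H},\mathcal{H}_j)$ is the set of adjointable $\mathcal{A}$-linear operators $\mathcal{H}\to\mathcal{H}_j$. $GL^+(\mathcal{H})$ is the set of all positive bounded linear invertible operators on $\mathcal{H}$ with bounded inverse. For $C,C'\in GL^+(\mathcal{H})$, a family $\{\Lambda_j\in End_{\mathcal{A}}^*(\mathcal{H},\mathcal{H}_j):j\in J\}$ is a $(C,C')$-controlled g-frame for $\mathcal{H}$ with respect to $\{\mathcal{H}_j\}_{j\in J}$ if there exist constants $0<A\le B<\infty$ such that $A\langle f,f\rangle\le\sum_{j\in J}\langle\Lambda_jCf,\Lambda_jC'f\rangle\le B\langle f,f\rangle$ for all $f\in\mathcal{H}$. It is a $(C,C')$-controlled g-Bessel sequence if there exists a constant $0<B<\infty$ such that $\sum_{j\in J}\langle\Lambda_jCf,\Lambda_jC'f\rangle\le B\langle f,f\rangle$ for all $f\in\mathcal{H}$. *)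

(* Defs.v *)
From HB Require Import structures.
From mathcomp Require Import all_boot all_order all_algebra.
From mathcomp Require Import complex.
From mathcomp Require Import all_classical all_reals all_analysis.
From mathcomp Require summability.

Set Implicit Arguments.
Unset Strict Implicit.
Unset Printing Implicit Defensive.

Import Order.TTheory GRing.Theory Num.Theory.
Import numFieldNormedType.Exports.

Local Open Scope classical_set_scope.
Local Open Scope ring_scope.
Local Open Scope complex_scope.

(* The norm of a [normedModType R[i]] takes its values in [R[i]]; since
   [0 <= x] in [R[i]] means that [x] is real and nonnegative, these are the
   usual real norms, and real bounds are embedded by [%:C].
   The product is a field of the mixin because a type cannot inherit both from
   [normedModType R[i]] and from the ring structures of MathComp: Hierarchy
   Builder would need a join that [numDomainType] inherits from. *)
HB.mixin Record isCStarAlgebra (R : realType) A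
    & CompleteNormedModule R[i] A := {
  amul : A -> A -> A;
  aone : A;
  star : A -> A;
  amulA : forall a b c : A, amul a (amul b c) = amul (amul a b) c;
  amul1l : forall a : A, amul aone a = a;
  amul1r : forall a : A, amul a aone = a;
  amulDl : forall a b c : A, amul (a + b) c = amul a c + amul b c;
  amulDr : forall a b c : A, amul a (b + c) = amul a b + amul a c;
  amulZl : forall (l : R[i]) (a b : A), amul (l *: a) b = l *: amul a b;
  amulZr : forall (l : R[i]) (a b : A), amul a (l *: b) = l *: amul a b;
  normM_le : forall a b : A, `|amul a b| <= `|a| * `|b|;
  starD : forall a b : A, star (a + b) = star a + star b;
  starZ : forall (l : R[i]) (a : A), star (l *: a) = l^* *: star a;
  starM : forall a b : A, star (amul a b) = amul (star b) (star a);
  starK : forall a : A, star (star a) = a;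
  norm_starM : forall a : A, `|amul (star a) a| = `|a| ^+ 2
}.

#[short(type="cstarAlgType")]
HB.structure Definition CStarAlgebra (R : realType) :=
  {A of CompleteNormedModule R[i] A & isCStarAlgebra R A}.

Section positive_elements.
Context (R : realType) (A : cstarAlgType R).

Definition invertible (a : A) : Prop :=
  exists b : A, amul a b = aone /\ amul b a = aone.

Definition spectrum (a : A) : set R[i] :=
  [set l | ~ invertible (l *: aone - a)].

Definition cstar_pos (a : A) : Prop :=
  star a = a /\ forall l, spectrum a l -> 0 <= l.

Definition cstar_le (a b : A) : Prop := cstar_pos (b - a).

End positive_elements.

(* The action of [A] is a separate operation [act] because the [lmodType]
   structure of a Hilbert module is its structure of complex vector space;
   [actZ] (with [act1]) makes the two compatible. *)
HB.mixin Record isHilbertModule (R : realType) (A : cstarAlgType R) H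
    & CompleteNormedModule R[i] H := {
  act : A -> H -> H;
  actDl : forall (a b : A) (f : H), act (a + b) f = act a f + act b f;
  actDr : forall (a : A) (f g : H), act a (f + g) = act a f + act a g;
  actM : forall (a b : A) (f : H), act (amul a b) f = act a (act b f);
  act1 : forall f : H, act aone f = f;
  actZ : forall (l : R[i]) (a : A) (f : H), act (l *: a) f = l *: act a f;
  inner : H -> H -> A;
  innerDl : forall f g h : H, inner (f + g) h = inner f h + inner g h;
  inner_actl : forall (a : A) (f g : H), inner (act a f) g = amul a (inner f g);
  inner_star : forall f g : H, star (inner f g) = inner g f;
  inner_pos : forall f : H, cstar_pos (inner f f);
  inner_eq0 : forall f : H, inner f f = 0 -> f = 0;
  norm_inner : forall f : H, `|f| = sqrtC `|inner f f|
}.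

#[short(type="hilbertModType")]
HB.structure Definition HilbertModule (R : realType) (A : cstarAlgType R) :=
  {H of CompleteNormedModule R[i] H & isHilbertModule R A H}.

Record closedSubmod (R : realType) (A : cstarAlgType R)
    (H : hilbertModType A) := ClosedSubmod {
  carrier :> set H;
  carrier0 : carrier 0;
  carrierD : forall f g, carrier f -> carrier g -> carrier (f + g);
  carrier_act : forall (a : A) f, carrier f -> carrier (act a f);
  carrier_closed : closed carrier
}.

Section submodule_type.
Context (R : realType) (A : cstarAlgType R) (H : hilbertModType A).
Variable M : closedSubmod H.

Definition submod_pred : {pred H} := [pred f : H | f \in carrier M].

Record submod := Submod { submod_val : H; _ : submod_val \in submod_pred }.

HB.instance Definition _ := [isSub for submod_val].
HB.instance Definition _ := [Choice of submod by <:].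

Lemma scale_act (l : R[i]) (f : H) : l *: f = act (l *: (aone : A)) f.
Proof. by rewrite actZ act1. Qed.

Lemma submod_closed_pred : subsemimod_closed submod_pred.
Proof.
split; first split.
- by rewrite !inE; exact: carrier0.
- move=> f g; rewrite !inE => Mf Mg; exact: carrierD.
- move=> l f; rewrite !inE => Mf; rewrite scale_act; exact: carrier_act.
Qed.

HB.instance Definition _ :=
  GRing.SubChoice_isSubLmodule.Build R[i] H submod_pred submod
    submod_closed_pred.

Let norm (f : submod) : R[i] := `|val f|.

Let ler_normD f g : norm (f + g) <= norm f + norm g.
Proof. by rewrite /norm raddfD ler_normD. Qed.

Let normrZ (l : R[i]) f : norm (l *: f) = `|l| * norm f.
Proof. by rewrite /norm linearZ normrZ. Qed.

Let normr0_eq0 f : norm f = 0 -> f = 0.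
Proof. by move=> /normr0_eq0 f0; apply/val_inj; rewrite f0 raddf0. Qed.

HB.instance Definition _ :=
  Lmodule_isNormed.Build R[i] submod ler_normD normrZ normr0_eq0.

Lemma submod_normE (f : submod) : `|f| = `|val f|.
Proof. by []. Qed.

Lemma submod_complete (F : set_system submod) :
  ProperFilter F -> cauchy F -> cvg F.
Proof.
move=> FF /cauchy_ballP Fc.
have GF : ProperFilter (val @ F) by exact: fmap_proper_filter.
have /cauchy_cvg /cvg_ex[/= h Gh] : cauchy (val @ F : set_system H).
  apply/cauchy_ballP => e e0; have := Fc e e0.
  case=> -[P Q] /= [FP FQ] PQ; exists (val @` P, val @` Q).
    by split; [apply: filterS FP|apply: filterS FQ] => f Pf; exists f.
  move=> _ [/= [f Pf <-] [g Qg <-]]; have /= := PQ (f, g) (conj Pf Qg).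
  by rewrite -!ball_normE /= submod_normE raddfB.
have Mh : h \in submod_pred.
  rewrite inE.
  apply: (@closed_cvg _ _ _ _ val (carrier M) (@carrier_closed _ _ _ M) _ h Gh).
  by apply: nearW => f; have := valP f; rewrite inE.
apply/cvg_ex; exists (Submod Mh); apply/cvgrPdist_lt => e e0.
move/cvgrPdist_lt : Gh => /(_ e e0); apply: filterS => f /=.
by rewrite submod_normE raddfB.
Qed.

HB.instance Definition _ := Uniform_isComplete.Build submod submod_complete.

Lemma submod_act_subproof (a : A) (f : submod) : act a (val f) \in submod_pred.
Proof. by have := valP f; rewrite !inE; exact: carrier_act. Qed.

Let sact (a : A) (f : submod) : submod := Submod (submod_act_subproof a f).

Let sinner (f g : submod) : A := inner (val f) (val g).

Let sactDl a b f : sact (a + b) f = sact a f + sact b f.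
Proof. by apply/val_inj; rewrite raddfD /= actDl. Qed.

Let sactDr a f g : sact a (f + g) = sact a f + sact a g.
Proof. by apply/val_inj; rewrite /= ?raddfD /= ?raddfD actDr. Qed.

Let sactM a b f : sact (amul a b) f = sact a (sact b f).
Proof. by apply/val_inj; rewrite /= actM. Qed.

Let sact1 f : sact aone f = f.
Proof. by apply/val_inj; rewrite /= act1. Qed.

Let sactZ (l : R[i]) a f : sact (l *: a) f = l *: sact a f.
Proof. by apply/val_inj; rewrite linearZ /= actZ. Qed.

Let sinnerDl f g h : sinner (f + g) h = sinner f h + sinner g h.
Proof. by rewrite /sinner raddfD innerDl. Qed.

Let sinner_actl a f g : sinner (sact a f) g = amul a (sinner f g).
Proof. exact: inner_actl. Qed.

Let sinner_star f g : star (sinner f g) = sinner g f.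
Proof. exact: inner_star. Qed.

Let sinner_pos f : cstar_pos (sinner f f).
Proof. exact: inner_pos. Qed.

Let sinner_eq0 f : sinner f f = 0 -> f = 0.
Proof. by move=> /inner_eq0 f0; apply/val_inj; rewrite f0 raddf0. Qed.

Let snorm_inner f : `|f| = sqrtC `|sinner f f|.
Proof. by rewrite submod_normE norm_inner. Qed.

HB.instance Definition _ := isHilbertModule.Build R A submod
  sactDl sactDr sactM sact1 sactZ sinnerDl sinner_actl sinner_star
  sinner_pos sinner_eq0 snorm_inner.

Lemma submod_innerE (f g : submod) : inner f g = inner (val f) (val g).
Proof. by []. Qed.

Lemma submod_actE (a : A) (f : submod) : val (act a f) = act a (val f).
Proof. by []. Qed.

End submodule_type.

Section operators.
Context (R : realType) (A : cstarAlgType R).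

Record adjointable (E F : hilbertModType A) := Adjointable {
  adj_op :> E -> F;
  adj : F -> E;
  adj_opD : forall f g, adj_op (f + g) = adj_op f + adj_op g;
  adj_op_act : forall (a : A) f, adj_op (act a f) = act a (adj_op f);
  adjP : forall f g, inner (adj_op f) g = inner f (adj g)
}.

Definition bounded_op (E F : hilbertModType A) (T : E -> F) : Prop :=
  exists c : R, forall f, `|T f| <= c%:C * `|f|.

Definition GLplus (H : hilbertModType A) (C : {linear H -> H}) : Prop :=
  [/\ bounded_op C,
      (exists D : H -> H, [/\ cancel C D, cancel D C & bounded_op D])
    & forall f, cstar_pos (inner (C f) f)].

End operators.

(* Sums over an arbitrary index set are unordered: limits in norm of the net of
   finite partial sums. *)
Definition net_summable (R : realType) (V : completeNormedModType R[i])
    (J : choiceType) (u : J -> V) : Prop :=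
  cvg (summability.partial_sum u @ summability.totally).

Section controlled_gframes.
Context (R : realType) (A : cstarAlgType R) (H : hilbertModType A).
Context (J : choiceType) (K : J -> hilbertModType A).
Variables (C C' : {linear H -> H}).

Definition controlled_term (L : forall j, adjointable H (K j)) (f : H)
    (j : J) : A :=
  inner (L j (C f)) (L j (C' f)).

Definition controlled_gframe (L : forall j, adjointable H (K j)) : Prop :=
  exists a b : R, 0 < a <= b /\
    forall f, let u := controlled_term L f in
      [/\ net_summable u,
          cstar_le (a%:C *: inner f f) (summability.sum u)
        & cstar_le (summability.sum u) (b%:C *: inner f f)].

Definition controlled_gbessel (L : forall j, adjointable H (K j)) : Prop :=
  exists2 b : R, 0 < b &
    forall f, let u := controlled_term L f in
      net_summable u /\ cstar_le (summability.sum u) (b%:C *: inner f f).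

(* [summability.sum] is a total [lim]. The series converges for every [f] as soon
   as [L] is a g-frame, [G] is a g-Bessel sequence, and [C] and [C'] commute with
   each other, with every [adj (L j) \o L j] and with every
   [adj (G j) \o G j]. *)
Definition controlled_cross_op (G L : forall j, adjointable H (K j)) (f : H) :
    H :=
  summability.sum (fun j => C' (adj (G j) (L j (C f)))).

End controlled_gframes.

(* Main.v *)
(* Write [G_j = Gamma_j^* Gamma_j]. As C and C' are positive, invertible and
   commute with each other and with [G_j], one has
   [<Gamma_j C f, Gamma_j C' f> = <U_j f, f>] where [U_j = G_j C C'] is positive
   and comparable with [G_j]. The order bound on the partial sums of the [U_j]
   makes them converge strongly to a positive bounded operator [S] with
   [<S f, f>] equal to the controlled sum, so that the lower frame bound says
   that [S] is bounded below in the order of [A].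
   Cauchy-Schwarz bounds [<L f, g>] in terms of [f] and [<S C' g, C' g>]; as
   [L] is onto, the Banach-Steinhaus theorem then bounds [g], whence
   [|S k| >= m |k|] for some [m > 0]. So [S + r] is bounded below by [m] for all
   [r >= 0], hence onto down to [r = 0], and [<f, f> <= |S^-1| <S f, f>].
   Operator inequalities are all obtained without functional calculus, from
   [<G T f, f> <= |T| <G f, f>] for commuting symmetric [G], [T] with [G >= 0].
   In [A] itself, positivity of a self-adjoint [x] is expressed by
   [|t - x| <= t] for [t >= |x|]; this rests on [|x|] or [-|x|] being in the
   spectrum of [x], for which Rickart's averaging over roots of unity replaces
   complex analysis. *)

Require Import Defs.
From HB Require Import structures.
From mathcomp Require Import all_boot all_order all_algebra.
From mathcomp Require Import complex.
From mathcomp Require Import all_classical all_reals all_analysis.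
From mathcomp Require Import ring lra.
From mathcomp Require Import finmap.
From mathcomp Require summability.

Set Implicit Arguments.
Unset Strict Implicit.
Unset Printing Implicit Defensive.

Import Order.TTheory GRing.Theory Num.Theory.
Import numFieldNormedType.Exports.

Local Open Scope classical_set_scope.
Local Open Scope ring_scope.
Local Open Scope complex_scope.

(** * Real-valued norms and real scalars *)

Section real_norm.
Context (R : realType) (V : completeNormedModType R[i]).
Implicit Types (x y : V) (r : R).

Definition rnorm x : R := complex.Re `|x|.

Lemma rnormE x : `|x| = (rnorm x)%:C.
Proof. by rewrite /rnorm RRe_real // normr_real. Qed.

Lemma rnorm_ge0 x : 0 <= rnorm x.
Proof. by rewrite -ler0c -rnormE normr_ge0. Qed.

Lemma rnorm0 : rnorm (0 : V) = 0.
Proof. by apply: complexI; rewrite -rnormE normr0. Qed.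

Lemma rnormN x : rnorm (- x) = rnorm x.
Proof. by rewrite /rnorm normrN. Qed.

Lemma rnormD x y : rnorm (x + y) <= rnorm x + rnorm y.
Proof. by rewrite -lecR rmorphD /= -!rnormE ler_normD. Qed.

Lemma rnormB x y : rnorm (x - y) <= rnorm x + rnorm y.
Proof. by rewrite -(rnormN y) rnormD. Qed.

Lemma rnorm_distC x y : rnorm (x - y) = rnorm (y - x).
Proof. by rewrite -rnormN opprB. Qed.

Lemma rnormZc (l : R[i]) x : rnorm (l *: x) = complex.Re `|l| * rnorm x.
Proof.
by apply: complexI; rewrite -rnormE normrZ rnormE rmorphM /= (RRe_real
  (normr_real l)).
Qed.

Lemma rnormZ r x : rnorm (r%:C *: x) = `|r| * rnorm x.
Proof. by rewrite rnormZc normc_def /= expr0n /= addr0 sqrtr_sqr. Qed.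

Lemma rnorm_eq0 x : rnorm x = 0 -> x = 0.
Proof. by move=> x0; apply/normr0_eq0; rewrite rnormE x0. Qed.

End real_norm.

(* Restricting the scalars to [R] gives access to Banach's fixed point theorem
   and to the Banach-Steinhaus theorem, which the library has over [R] only. *)
Definition realified (R : realType) (V : completeNormedModType R[i]) : Type :=
  V.

Section realified.
Context (R : realType) (V : completeNormedModType R[i]).
Local Notation W := (realified V).

HB.instance Definition _ := GRing.Zmodule.copy W V.

Let rscale (r : R) (x : W) : W := r%:C *: (x : V).

Let rscaleA a b x : rscale a (rscale b x) = rscale (a * b) x.
Proof. by rewrite /rscale rmorphM scalerA. Qed.
Let rscale1 x : rscale 1 x = x.
Proof. exact: scale1r. Qed.
Let rscaleDr : right_distributive rscale +%R.
Proof. by move=> a x y; exact: scalerDr. Qed.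
Let rscaleDl x : {morph rscale^~ x : a b / a + b}.
Proof. by move=> a b; rewrite /rscale rmorphD /= scalerDl. Qed.

HB.instance Definition _ :=
  GRing.Zmodule_isLmodule.Build R W rscaleA rscale1 rscaleDr rscaleDl.

Let norm (x : W) : R := rnorm (x : V).
Let normD x y : norm (x + y) <= norm x + norm y.
Proof. exact: rnormD. Qed.
Let normZ r x : norm (r *: x) = `|r| * norm x.
Proof. exact: rnormZ. Qed.
Let norm_eq0 x : norm x = 0 -> x = 0.
Proof. exact: rnorm_eq0. Qed.

HB.instance Definition _ := Lmodule_isNormed.Build R W normD normZ norm_eq0.

Lemma realified_complete (F : set_system W) :
  ProperFilter F -> cauchy F -> cvg F.
Proof.
move=> FF /cauchy_ballP Fc.
have /cauchy_cvg /cvg_ex[/= h Gh] : cauchy (F : set_system V).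
  apply/cauchy_ballP => e e0.
  have e'0 : 0 < complex.Re e by move: e0; rewrite ltcE /= => /andP[].
  have := Fc _ e'0; case=> -[P Q] /= [FP FQ] PQ; exists (P, Q) => // -[x y] Pxy.
  have := PQ (x, y) Pxy; rewrite -!ball_normE /= rnormE.
  by rewrite -ltcR (RRe_real (gtr0_real e0)).
apply/cvg_ex; exists (h : W); apply/cvgrPdist_lt => e e0.
have e'0 : 0 < e%:C by rewrite ltcR.
move/cvgrPdist_lt : Gh => /(_ _ e'0); apply: filterS => f /=.
by rewrite rnormE ltcR.
Qed.

HB.instance Definition _ := Uniform_isComplete.Build W realified_complete.

Lemma contraction_fixpoint (f : V -> V) (q : R) : 0 <= q < 1 ->
  (forall x y, rnorm (f x - f y) <= q * rnorm (x - y)) -> exists x, x = f x.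
Proof.
move=> /andP[q0 q1] fq.
pose g : {fun [set: W] >-> [set: W]} := totalfun (f : W -> W).
have : @is_contraction R W W setT setT g.
  exists (NngNum q0); split=> //= -[x y] _ /=; exact: fq.
move=> /banach_fixed_point /(_ closedT) [|x _ fx]; first by exists 0.
by exists x.
Qed.

End realified.

(** * C*-algebras: positivity through the norm *)

Section cstar_algebra.
Context (R : realType) (A : cstarAlgType R).
Implicit Types (a b c h p q x y : A) (l z w : R[i]) (r s t : R).

Local Notation cmod l := (complex.Re `|l|).
Local Notation "a ** b" := (amul a b) (at level 40, left associativity).
Local Notation one := (aone : A).

Lemma cmod_sqr l : cmod l ^+ 2 = complex.Re l ^+ 2 + complex.Im l ^+ 2.
Proof. by rewrite normc_def /= sqr_sqrtr // addr_ge0 // sqr_ge0. Qed.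

Lemma cmod_ge0 l : 0 <= cmod l.
Proof. by rewrite normc_def /= sqrtr_ge0. Qed.

Lemma cmodM l z : cmod (l * z) = cmod l * cmod z.
Proof. rewrite normrM -(RRe_real (normr_real l)) -(RRe_real (normr_real z)).
by rewrite -rmorphM. Qed.

Lemma cmodR r : cmod r%:C = `|r|.
Proof. by rewrite normc_def /= expr0n addr0 sqrtr_sqr. Qed.

Lemma amul0l a : 0 ** a = 0.
Proof. by apply: (addrI (0 ** a)); rewrite -amulDl !addr0. Qed.

Lemma amul0r a : a ** 0 = 0.
Proof. by apply: (addrI (a ** 0)); rewrite -amulDr !addr0. Qed.

Lemma amulNl a b : (- a) ** b = - (a ** b).
Proof. by apply: (addIr (a ** b)); rewrite -amulDl !addNr amul0l. Qed.

Lemma amulNr a b : a ** (- b) = - (a ** b).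
Proof. by apply: (addIr (a ** b)); rewrite -amulDr !addNr amul0r. Qed.

Lemma amulBl a b c : (a - b) ** c = a ** c - b ** c.
Proof. by rewrite amulDl amulNl. Qed.

Lemma amulBr a b c : a ** (b - c) = a ** b - a ** c.
Proof. by rewrite amulDr amulNr. Qed.

Lemma star0 : star (0 : A) = 0.
Proof. by apply: (addrI (star 0)); rewrite -starD !addr0. Qed.

Lemma starN a : star (- a) = - star a.
Proof. by apply: (addrI (star a)); rewrite -starD !subrr star0. Qed.

Lemma starB a b : star (a - b) = star a - star b.
Proof. by rewrite starD starN. Qed.

Lemma conjE l : Num.conj l = conjc l.
Proof. by []. Qed.

Lemma starZr r a : star (r%:C *: a) = r%:C *: star a.
Proof. by rewrite starZ conjE conjc_real. Qed.

Lemma star1 : star one = one.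
Proof. by rewrite -[RHS]starK -{2}[star one]amul1r starM starK amul1r. Qed.

Lemma rnormM a b : rnorm (a ** b) <= rnorm a * rnorm b.
Proof. by rewrite -lecR rmorphM /= -!rnormE normM_le. Qed.

Lemma rnorm_starM a : rnorm (star a ** a) = rnorm a ^+ 2.
Proof. by apply: complexI; rewrite rmorphXn /= -!rnormE norm_starM. Qed.

Lemma rnorm_sa a : star a = a -> rnorm (a ** a) = rnorm a ^+ 2.
Proof. by move=> sa; rewrite -{1}sa rnorm_starM. Qed.

Lemma rnorm_star a : rnorm (star a) = rnorm a.
Proof.
suff le b : rnorm b <= rnorm (star b).
  by apply/le_anti; rewrite le andbT -{2}[a]starK le.
have := rnormM (star b) b; rewrite rnorm_starM.
have := rnorm_ge0 b; have := rnorm_ge0 (star b); nra.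
Qed.

(** The C*-identity gives [|1| = |1|^2]; an inequality also covers the zero algebra, where
    [|1| = 0]. *)
Lemma rnorm1_le : rnorm one <= 1.
Proof.
have := rnorm_starM one; rewrite star1 amul1l.
have := rnorm_ge0 one; nra.
Qed.

Lemma rnormM_le a b r s : rnorm a <= r -> rnorm b <= s ->
  rnorm (a ** b) <= r * s.
Proof.
move=> ar bs; apply: le_trans (rnormM a b) _.
by apply: ler_pM => //; exact: rnorm_ge0.
Qed.

Definition inverse a x := a ** x = one /\ x ** a = one.

Lemma inverse_scale l a x : l != 0 -> inverse a x ->
  inverse (l *: a) (l^-1 *: x).
Proof.
by move=> l0 [ax xa]; split;
  rewrite amulZl amulZr scalerA ?ax ?xa ?mulfV ?mulVf // scale1r.
Qed.

(** In place of a Neumann series, a right and a left inverse are obtained as fixed points of the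
    contractions [x |-> 1 + q x] and [x |-> 1 + x q]; associativity makes them equal. *)
Lemma inverse_neumann q r : rnorm q <= r -> r < 1 ->
  exists2 x, inverse (one - q) x & rnorm x <= (1 - r)^-1.
Proof.
move=> qr r1; have r0 : 0 <= r by rewrite (le_trans (rnorm_ge0 q)).
have r01 : 0 <= r < 1 by rewrite r0.
have [|x xE] := @contraction_fixpoint _ A (fun x => one + q ** x) r r01.
  move=> x y; rewrite opprD addrACA subrr add0r -amulBr.
  by apply: le_trans (rnormM _ _) _; rewrite ler_wpM2r // rnorm_ge0.
have [|x' x'E] := @contraction_fixpoint _ A (fun x => one + x ** q) r r01.
  move=> y z; rewrite opprD addrACA subrr add0r -amulBl mulrC.
  by apply: le_trans (rnormM _ _) _; rewrite ler_wpM2l // rnorm_ge0.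
have qx : (one - q) ** x = one by rewrite amulBl amul1l {1}xE addrK.
have x'q : x' ** (one - q) = one by rewrite amulBr amul1r {1}x'E addrK.
have ex : x' = x by rewrite -[x']amul1r -qx amulA x'q amul1l.
exists x; first by split=> //; rewrite -{1}ex.
have : rnorm x <= 1 + r * rnorm x.
  rewrite {1}xE; apply: le_trans (rnormD _ _) _; apply: lerD;
    first exact: rnorm1_le.
  exact: rnormM_le.
rewrite -[X in _ -> _ <= X]mul1r ler_pdivlMr ?subr_gt0 //; nra.
Qed.

Lemma inverse_perturb a x d K : inverse a x -> rnorm x <= K ->
  rnorm d * K <= 2^-1 ->
  exists2 y, inverse (a - d) y & rnorm y <= 2 * K.
Proof.
move=> [ax xa] xK dK.
have K0 : 0 <= K := le_trans (rnorm_ge0 x) xK.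
have xd : rnorm (x ** d) <= 2^-1.
  apply: le_trans (rnormM _ _) _; apply: le_trans dK.
  by rewrite mulrC ler_wpM2l // rnorm_ge0.
have [|y [y1 y2] yK] := inverse_neumann xd; first lra.
have -> : a - d = a ** (one - x ** d) by rewrite amulBr amul1r amulA ax amul1l.
exists (y ** x).
  by split; rewrite ?amulA -1?[_ ** x ** a]amulA ?xa -1?[a ** _ ** y]amulA ?y1
     ?amul1r // -[y ** x ** a]amulA xa amul1r.
have -> : 2 * K = (1 - 2^-1)^-1 * K by field.
exact: rnormM_le.
Qed.

Lemma spectrum_norm a l : spectrum a l -> cmod l <= rnorm a.
Proof.
move=> sl; rewrite leNgt; apply/negP => al; apply: sl.
have l0 : l != 0.
  by apply: contraTneq al => ->; rewrite normr0 /= -leNgt rnorm_ge0.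
have cl : 0 < cmod l by exact: le_lt_trans (rnorm_ge0 a) al.
have [|x [x1 x2] _] := @inverse_neumann (l^-1 *: a) _ (lexx _).
  rewrite rnormZc -(ltr_pM2l cl) mulrA -cmodM mulfV // normr1 /= mul1r mulr1 //.
exists (l^-1 *: x).
have -> : l *: one - a = l *: (one - l^-1 *: a).
  by rewrite scalerBr scalerA mulfV // scale1r.
by have [] := @inverse_scale l _ x l0 (conj x1 x2).
Qed.

Lemma star_shift l h : star h = h -> star (h + l *: one) = h + conjc l *: one.
Proof. by move=> sh; rewrite starD starZ star1 sh. Qed.

End cstar_algebra.

(** * Spectrum and resolvent of a self-adjoint element *)

Section spectrum_selfadjoint.
Context (R : realType) (A : cstarAlgType R).
Implicit Types (a b c h p q x y : A) (l z w : R[i]) (r s t : R).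

Local Notation cmod l := (complex.Re `|l|).
Local Notation "a ** b" := (amul a b) (at level 40, left associativity).
Local Notation one := (aone : A).

Lemma amul_shift h z w :
  (h + z *: one) ** (h + w *: one) = h ** h + (z + w) *: h + (z * w) *: one.
Proof.
rewrite amulDl !amulDr !amulZl !amulZr !amul1l amul1r scalerDl scalerA.
by rewrite -!addrA; congr (_ + _); rewrite addrCA.
Qed.

Lemma rnorm_shift_imag h t : star h = h ->
  rnorm (h + (0 +i* t) *: one) ^+ 2 <= rnorm h ^+ 2 + t ^+ 2.
Proof.
move=> sh; rewrite -rnorm_starM star_shift // amul_shift.
have -> : (0 +i* t)^*%C + (0 +i* t) = 0 by simpc; rewrite addNr.
have -> : (0 +i* t)^*%C * (0 +i* t) = (t ^+ 2)%:C.
  by simpc; rewrite expr2.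
rewrite scale0r addr0; apply: le_trans (rnormD _ _) _.
rewrite rnorm_sa // lerD2l rnormZ ger0_norm ?sqr_ge0 //.
by rewrite ler_piMr ?sqr_ge0 // rnorm1_le.
Qed.

(** Arens's trick: [l + it] lies in the spectrum of [h + it], whose squared norm is at most
    [|h|^2 + t^2]. The left side contains a term linear in [t] unless [Im l = 0]. *)
Lemma spectrum_sa_real h l : star h = h -> spectrum h l -> complex.Im l = 0.
Proof.
move=> sh sl; apply/eqP; apply: contraT => b0.
have bound t : complex.Re l ^+ 2 + (complex.Im l + t) ^+ 2 <= rnorm h ^+ 2 + t
  ^+ 2.
  have /spectrum_norm : spectrum (h + (0 +i* t) *: one) (l + (0 +i* t)).
    by rewrite /spectrum /= scalerDl opprD addrACA subrr addr0.
  move=> lh; apply: le_trans (rnorm_shift_imag t sh).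
  have -> : complex.Re l ^+ 2 + (complex.Im l + t) ^+ 2 = cmod (l + (0 +i* t))
    ^+ 2.
    by rewrite cmod_sqr; case: (l) => u v /=; rewrite addr0.
  by rewrite lerXn2r // nnegrE ?cmod_ge0 ?rnorm_ge0.
(* This [t] makes the linear term [2 t Im l] equal to [|h|^2 + 1], which already exceeds what
   [bound] allows. *)
have := bound ((rnorm h ^+ 2 + 1) / (2 * complex.Im l)).
set b := complex.Im l in b0 *; set N := rnorm h ^+ 2.
have -> : (b + (N + 1) / (2 * b)) ^+ 2 = b ^+ 2 + (N + 1) + ((N + 1) / (2 * b))
  ^+ 2.
  by field.
have := sqr_ge0 (complex.Re l); have := sqr_ge0 b; lra.
Qed.

(* [(1 - ish)(1 + ish) = 1 + s^2 h^2] bounds [rnorm ((1 + ish) y)] below to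
   first order in [s]; as it is convex in [s], the bound holds for all [s]. *)
Lemma rnorm_accretive h s y : star h = h ->
  rnorm y <= rnorm ((one + (0 +i* s) *: h) ** y).
Proof.
move=> sh.
pose f t := rnorm ((one + (0 +i* t) *: h) ** y).
pose k := rnorm h ^+ 2.
have k0 : 0 <= k by exact: sqr_ge0.
have y0 := rnorm_ge0 y.
have local t : (1 - 2 * k * t ^+ 2) * rnorm y <= f t.
  have normh : rnorm (one + (0 +i* - t) *: h) <= 1 + k * t ^+ 2.
    have sq : rnorm (one + (0 +i* - t) *: h) ^+ 2 <= 1 + k * t ^+ 2.
      rewrite -rnorm_starM starD star1 starZ sh conjE.
      have -> : (0 +i* - t)^*%C = - (0 +i* - t) :> R[i]
        by rewrite /= -[RHS]/(- 0 +i* - - t) oppr0.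
      rewrite scaleNr amulBl !amulDr !amul1l amul1r amulZl amulZr scalerA.
      rewrite opprD addrA addrK -scaleNr.
      have -> : - ((0 +i* - t) * (0 +i* - t)) = (t ^+ 2)%:C :> R[i].
        by simpc; rewrite expr2.
      apply: le_trans (rnormD _ _) _; apply: lerD (rnorm1_le A) _.
      by rewrite rnormZ rnorm_sa // ger0_norm ?sqr_ge0 // mulrC.
    have := rnorm_ge0 (one + (0 +i* - t) *: h).
    have := mulr_ge0 k0 (sqr_ge0 t); nra.
  have prod : rnorm y - k * t ^+ 2 * rnorm y <=
      rnorm ((one + (0 +i* - t) *: h) ** ((one + (0 +i* t) *: h) ** y)).
    rewrite amulA amulDl !amulDr !amul1l amul1r amulZl amulZr scalerA.
    rewrite -[X in X ** y]addrA [X in one + X]addrA -scalerDl.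
    have -> : (0 +i* t) + (0 +i* - t) = 0 :> R[i]
      by rewrite -[LHS]/((0 + 0) +i* (t - t)) addr0 subrr.
    have -> : (0 +i* - t) * (0 +i* t) = (t ^+ 2)%:C :> R[i].
      by simpc; rewrite expr2.
    rewrite scale0r add0r amulDl amul1l amulZl.
    have := rnormB (y + (t ^+ 2)%:C *: (h ** h ** y)) ((t ^+ 2)%:C *: (h ** h
      ** y)).
    rewrite addrK rnormZ ger0_norm ?sqr_ge0 //.
    have : rnorm (h ** h ** y) <= k * rnorm y.
      by apply: le_trans (rnormM _ _) _; rewrite rnorm_sa.
    have := sqr_ge0 t; nra.
  have := rnormM_le normh (lexx (f t)); move/(le_trans prod).
  have ft0 : 0 <= f t := rnorm_ge0 _.
  have kt0 := mulr_ge0 k0 (sqr_ge0 t); rewrite -/k in kt0 *; move: ft0 kt0 y0.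
  move: (f t) (rnorm y) => u v; set e := k * t ^+ 2.
  rewrite (_ : 2 * k * t ^+ 2 = 2 * e); last by rewrite /e mulrA.
  nra.
have convex e : 0 < e <= 1 -> (1 - 2 * k * s ^+ 2 * e) * rnorm y <= f s.
  move=> /andP[e0 e1].
  have : f (e * s) <= (1 - e) * rnorm y + e * f s.
    rewrite /f (_ : (0 +i* (e * s)) = e%:C * (0 +i* s) :> R[i]); last by simpc.
    have -> : one + (e%:C * (0 +i* s)) *: h =
        (1 - e)%:C *: one + e%:C *: (one + (0 +i* s) *: h).
      by rewrite scalerDr addrA -scalerDl -rmorphD /= subrK scale1r scalerA.
    rewrite amulDl !amulZl amul1l; apply: le_trans (rnormD _ _) _.
    by rewrite !rnormZ !ger0_norm ?subr_ge0 // ltW.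
  move=> /(le_trans (local _)); rewrite exprMn => H.
  rewrite -(ler_pM2l e0); move: H; move: (f s) (rnorm y) => u v.
  have -> : (1 - 2 * k * (e ^+ 2 * s ^+ 2)) * v =
     e * ((1 - 2 * k * s ^+ 2 * e) * v) + (1 - e) * v by ring.
  lra.
rewrite leNgt -/(f s); apply/negP => fy.
(* The loss in [convex] is [M * e]. The choice [e = d / (2 * (M + d))] is at most 1 and makes the
   loss smaller than the gap [d], contradicting [f s = rnorm y - d]. *)
pose M := 2 * k * s ^+ 2 * rnorm y.
have M0 : 0 <= M by rewrite mulr_ge0 // mulr_ge0 ?sqr_ge0 // mulr_ge0.
have d0 : 0 < rnorm y - f s by rewrite subr_gt0.
pose d := rnorm y - f s.
have f0 : 0 <= f s := rnorm_ge0 _.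
have den : 0 < 2 * (M + d) by rewrite /d; lra.
have := convex (d / (2 * (M + d))).
rewrite divr_gt0 //= ler_pdivrMr // mul1r.
have dM : d <= 2 * (M + d) by rewrite /d; lra.
move=> /(_ dM).
have -> : (1 - 2 * k * s ^+ 2 * (d / (2 * (M + d)))) * rnorm y =
   rnorm y - M * d / (2 * (M + d)) by rewrite /M; ring.
suff : M * d / (2 * (M + d)) < d by rewrite /d; lra.
rewrite ltr_pdivrMr //; rewrite -/d in d0; nra.
Qed.

(** With [l = a + ib], one has [l - h = ib (1 + i b^-1 (h - a))], so [rnorm_accretive] yields
    [|b| |x| <= |(l - h) x| = |1| <= 1]. *)
Lemma inverse_nonreal h l : star h = h -> complex.Im l != 0 ->
  exists2 x, inverse (l *: one - h) x & rnorm x <= `|complex.Im l|^-1.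
Proof.
move=> sh b0.
have [x [hx xh]] : invertible (l *: one - h).
  by apply: contrapT => /(spectrum_sa_real sh)/eqP; apply/negP.
exists x => //.
case: l b0 hx xh => a b /= b0 hx xh.
have e : (a +i* b) *: one - h =
    (0 +i* b) *: (one + (0 +i* b^-1) *: (h - a%:C *: one)).
  have -> : a +i* b = (0 +i* b) + a%:C :> R[i].
    by rewrite -[RHS]/((0 + a) +i* (b + 0)) add0r addr0.
  rewrite [RHS]scalerDr scalerA.
  have -> : (0 +i* b) * (0 +i* b^-1) = - 1 :> R[i].
    by simpc; rewrite mulfV //; apply/eqP; rewrite eq_complex /= oppr0 !eqxx.
  by rewrite scaleN1r opprB scalerDl addrA.
have sh' : star (h - a%:C *: one) = h - a%:C *: one.
  by rewrite starB starZr star1 sh.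
have := rnorm_accretive b^-1 x sh'.
have : rnorm ((0 +i* b) *: ((one + (0 +i* b^-1) *: (h - a%:C *: one)) ** x)) <=
  1.
  by rewrite -amulZl -e hx rnorm1_le.
rewrite rnormZc normc_def /= expr0n add0r sqrtr_sqr.
have bb : 0 < `|b| by rewrite normr_gt0.
move=> le1 le2; rewrite -(ler_pM2l bb) mulfV ?gt_eqF //.
by apply: le_trans le1; rewrite ler_pM2l.
Qed.

End spectrum_selfadjoint.

(** * The norm of a self-adjoint element is attained on its spectrum, up to sign *)

Section spectral_radius.
Context (R : realType) (A : cstarAlgType R).
Implicit Types (a b c h p q x y : A) (l z w : R[i]) (r s t : R).

Local Notation cmod l := (complex.Re `|l|).
Local Notation "a ** b" := (amul a b) (at level 40, left associativity).
Local Notation one := (aone : A).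

(** Away from the real axis, [1 - z b = z (conj z - b)] is handled by [inverse_nonreal]. Where
    [|Im z| < 1 / (4 K)], the point [z] is so close to 1 or -1 that [1 - z b] is a small
    perturbation of [1 - b] or [1 + b]. *)
Lemma inverse_circle b x1 x2 K z : star b = b -> rnorm b <= 1 -> 1 <= K ->
  inverse (one - b) x1 -> rnorm x1 <= K -> inverse (one + b) x2 ->
    rnorm x2 <= K ->
  cmod z = 1 -> exists2 x, inverse (one - z *: b) x & rnorm x <= 4 * K.
Proof.
move=> sb b1 K1 ix1 x1K ix2 x2K z1.
have K0 : 0 < K by lra.
have uv : complex.Re z ^+ 2 + complex.Im z ^+ 2 = 1
  by rewrite -cmod_sqr z1 expr1n.
have z0 : z != 0 by apply: contraTneq isT => z0; move: z1;
  rewrite z0 normr0 /= => /eqP; rewrite eq_sym oner_eq0.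
have [vK|Kv] := leP (4 * K)^-1 `|complex.Im z|.
  have v0 : complex.Im (conjc z) != 0.
    rewrite (_ : complex.Im _ = - complex.Im z); last by case: (z).
    by rewrite oppr_eq0 -normr_gt0 (lt_le_trans _ vK) // invr_gt0 mulr_gt0.
  have [x ix xK] := inverse_nonreal sb v0.
  exists (z^-1 *: x).
    have -> : one - z *: b = z *: (conjc z *: one - b).
      by rewrite scalerBr scalerA -sqr_normc -(RRe_real (normr_real z)) z1
        expr1n scale1r.
    exact: inverse_scale.
  have -> : rnorm (z^-1 *: x) = rnorm x.
    rewrite rnormZc; have := cmodM z^-1 z;
      rewrite mulVf // normr1 z1 mulr1 => <-.
    by rewrite mul1r.
  apply: le_trans xK _; rewrite (_ : complex.Im _ = - complex.Im z);
    last by case: (z).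
  by rewrite normrN -[leRHS]invrK lef_pV2 // ?posrE ?(lt_le_trans _ vK) //
    invr_gt0 mulr_gt0.
have v2 : complex.Im z ^+ 2 < (4 * K)^-1 ^+ 2.
  by rewrite -real_normK ?num_real // ltrXn2r // ?nnegrE ?normr_ge0.
have vK2 : complex.Im z ^+ 2 * K ^+ 2 <= 16^-1.
  have : (4 * K)^-1 ^+ 2 * K ^+ 2 = 16^-1 by field; rewrite gt_eqF.
  by move=> <-; apply: ler_wpM2r; [exact: sqr_ge0|exact: ltW].
(* Here [e] is a sign of [Re z]; as [|Re z| <= 1], [|z - e|^2 = 2 - 2 |Re z| <= 2 (Im z)^2]. *)
have half (e : R) : `|e| = 1 -> 0 <= e * complex.Re z ->
  rnorm ((z - e%:C) *: b) * K <= 2^-1.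
  move=> e1 eu.
  have e2 : e ^+ 2 = 1 by rewrite -real_normK ?num_real // e1 expr1n.
  have : cmod (z - e%:C) ^+ 2 <= 2 * complex.Im z ^+ 2.
    rewrite cmod_sqr; have -> : complex.Re (z - e%:C) = complex.Re z - e
      by case: (z).
    have -> : complex.Im (z - e%:C) = complex.Im z by case: (z) => * /=;
      rewrite oppr0 addr0.
    have -> : (complex.Re z - e) ^+ 2 = complex.Re z ^+ 2 - 2 * (e * complex.Re
      z) + 1.
      by rewrite sqrrB e2; ring.
    have : (e * complex.Re z) ^+ 2 = complex.Re z ^+ 2
      by rewrite exprMn e2 mul1r.
    have := sqr_ge0 (complex.Im z); move: uv eu.
    by set u := e * _; set d := complex.Re z ^+ 2; set f := complex.Im z ^+ 2;
      nra.
  rewrite rnormZc; move: (cmod_ge0 (z - e%:C)) => c0 c2.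
  have cb : cmod (z - e%:C) * rnorm b <= cmod (z - e%:C) by rewrite ler_piMr.
  have {cb} := ler_wpM2r (ltW K0) cb; move=> /le_trans; apply.
  rewrite -(ler_pXn2r (n := 2)) // ?nnegrE ?mulr_ge0 ?invr_ge0 // ?ltW //.
  rewrite exprMn; have := ler_wpM2r (sqr_ge0 K) c2; move: vK2; lra.
have [u0|u0] := leP 0 (complex.Re z).
  have [||x ix xK] := inverse_perturb ix1 x1K (half 1 _ _);
    rewrite ?normr1 ?mul1r //.
  exists x; last by apply: le_trans xK _; lra.
  by move: ix; rewrite scalerBl scale1r opprB addrACA addrA addrK.
have [||x ix xK] := inverse_perturb ix2 x2K (half (-1) _ _);
  rewrite ?normrN1 ?mulN1r ?oppr_ge0 ?ltW //.
exists x; last by apply: le_trans xK _; lra.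
move: ix; rewrite (_ : one + b - _ = one - z *: b) //.
by rewrite scalerBl rmorphN1 scaleN1r opprK opprD addrACA subrr addr0.
Qed.

(* Averaging the inverses of [1 - wb] and [1 + wb] gives the inverse of
   [1 - w^2 b^2]; so an [e] that works for [b] works for [b^2]. *)
Let close b r e := forall z, cmod z = 1 -> exists x y,
  [/\ inverse (one - z *: b) x, inverse (one - (r%:C * z) *: b) y
    & rnorm (x - y) <= e].

Lemma inverse_sqr w b x1 x2 :
  inverse (one - w *: b) x1 -> inverse (one + w *: b) x2 ->
  inverse (one - (w * w) *: (b ** b)) (2^-1%:C *: (x1 + x2)).
Proof.
move=> [ax1 x1a] [bx2 x2b].
have e1 : one - (w * w) *: (b ** b) = (one - w *: b) ** (one + w *: b).
  by rewrite amulBl !amulDr !amul1l amul1r amulZl amulZr scalerA opprD addrA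
    addrK.
have e2 : one - (w * w) *: (b ** b) = (one + w *: b) ** (one - w *: b).
  by rewrite amulDl !amulBr !amul1l amul1r amulZl amulZr scalerA addrA subrK.
have two : 2^-1%:C *: ((one + w *: b) + (one - w *: b)) = one.
  rewrite addrACA subrr addr0 -[one in LHS]scale1r -scalerDl scalerA.
  have -> : 1 + 1 = 2%:C :> R[i] by rewrite -[2]/(1 + 1) rmorphD rmorph1.
  by rewrite -rmorphM /= mulVf // scale1r.
split.
  by rewrite amulZr amulDr {1}e2 e1 -!amulA ax1 bx2 !amul1r.
by rewrite amulZl amulDl {1}e1 e2 !amulA x1a x2b !amul1l.
Qed.

Lemma close_sqr b r e : close b r e -> close (b ** b) (r * r) e.
Proof.
move=> H z z1; pose w := sqrtC z.
have ww : w * w = z by rewrite -expr2 sqrtCK.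
have w1 : cmod w = 1.
  have : cmod w ^+ 2 = 1 by rewrite expr2 -cmodM ww.
  by have := cmod_ge0 w; nra.
have [x1 [y1 [ix1 iy1 xy1]]] := H w w1.
have [|x2 [y2 [ix2 iy2 xy2]]] := H (- w); first by rewrite normrN.
move: ix2 iy2; rewrite mulrN !scaleNr !opprK => ix2 iy2.
exists (2^-1%:C *: (x1 + x2)), (2^-1%:C *: (y1 + y2)); split.
- by rewrite -ww; exact: inverse_sqr.
- have -> : (r * r)%:C * z = (r%:C * w) * (r%:C * w).
    by rewrite rmorphM /= -ww mulrACA.
  exact: inverse_sqr.
- rewrite -scalerBr rnormZ opprD addrACA ger0_norm ?invr_ge0 //.
  by have := rnormD (x1 - y1) (x2 - y2); lra.
Qed.

(** If both inverses existed, [(1 - z b)^-1] would be bounded on the unit circle, hence would change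
    by at most [1/8] from [z] to [r z] for some [r < 1]. Squaring keeps the [1/8] while
    [r ^ (2 ^ m)] tends to 0, so the inverse of [1 - b ^ (2 ^ m)] is close to 1, which is impossible
    for an element of norm 1. *)
Lemma rnorm1_not_inverse b x1 x2 : star b = b -> rnorm b = 1 ->
  inverse (one - b) x1 -> inverse (one + b) x2 -> False.
Proof.
move=> sb b1 ix1 ix2.
pose K0 := 1 + rnorm x1 + rnorm x2; pose K := 4 * K0.
have x10 := rnorm_ge0 x1; have x20 := rnorm_ge0 x2.
have K01 : 1 <= K0 by rewrite /K0; lra.
have x1K : rnorm x1 <= K0 by rewrite /K0; lra.
have x2K : rnorm x2 <= K0 by rewrite /K0; lra.
have K1 : 1 <= K by rewrite /K; lra.
(* By [inverse_circle] and [inverse_perturb] the inverses at [z] and [r z] are bounded by [K] and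
   [2 K], so they differ by at most [2 t K^2 = 1/8]. *)
pose t := (16 * K ^+ 2)^-1; pose r := 1 - t.
have K2 : 1 <= K ^+ 2 by rewrite expr2; nra.
have t0 : 0 < t by rewrite invr_gt0; lra.
have tK : t * K ^+ 2 = 16^-1 by rewrite /t; field; rewrite gt_eqF //; lra.
have t1 : t <= 16^-1 by nra.
have r0 : 0 <= r by rewrite /r; lra.
have H : close b r 8^-1.
  move=> z z1.
  have bb : rnorm b <= 1 by rewrite b1.
  have [x ix xK] := inverse_circle sb bb K01 ix1 x1K ix2 x2K z1.
  have bz : rnorm ((- (t%:C * z)) *: b) = t.
    by rewrite rnormZc b1 mulr1 normrN cmodM z1 mulr1 cmodR gtr0_norm.
  have [|y iy yK] := inverse_perturb ix xK (d := - (t%:C * z) *: b).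
    by rewrite bz; move: tK; rewrite /K; nra.
  have e : one - z *: b - - (t%:C * z) *: b = one - (r%:C * z) *: b.
    rewrite /r rmorphB rmorph1 mulrBl mul1r scaleNr scalerBl !opprB opprK.
    by rewrite -addrA [- _ + _]addrC.
  rewrite e in iy; exists x, y; split => //.
  have -> : x - y = x ** ((t%:C * z) *: b) ** y.
    have [ax xa] := ix; have [ay ya] := iy.
    have -> : (t%:C * z) *: b = (one - (r%:C * z) *: b) - (one - z *: b).
      by rewrite -e scaleNr opprK addrAC subrr add0r.
    by rewrite amulBr amulBl xa -amulA ay amul1r amul1l.
  have : rnorm (x ** ((t%:C * z) *: b) ** y) <= (4 * K0 * t) * (2 * (4 * K0)).
    apply: rnormM_le => //; apply: rnormM_le => //.
    by move: bz; rewrite scaleNr rnormN => ->.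
  move=> /le_trans; apply; move: tK; rewrite -/K; nra.
have iterH m : exists bm, [/\ star bm = bm, rnorm bm = 1 & close bm (r ^+ (2 ^
  m)) 8^-1].
  elim: m => [|m [bm [sbm nbm Hm]]]; first by exists b.
  exists (bm ** bm); split; first by rewrite starM sbm.
    by rewrite rnorm_sa // nbm expr1n.
  by rewrite expnS mul2n -addnn exprD; exact: close_sqr.
have [m rm] : exists m, r ^+ (2 ^ m) <= 8^-1.
  have r1 : `|r| < 1 by rewrite ger0_norm //; rewrite /r; lra.
  have /cvgrPdist_lt /(_ 8^-1) := cvg_expr r1.
  rewrite invr_gt0 ltr0n => /(_ isT) [N _ HN]; exists N.
  have := HN (2 ^ N)%N (ltnW (ltn_expl N (ltnSn 1))) => /=.
  by rewrite sub0r normrN ger0_norm ?exprn_ge0 // => /ltW.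
have [bm [sbm nbm Hm]] := iterH m.
have [|x [y [[ax xa] [ay ya] xy]]] := Hm 1; first by rewrite normr1.
rewrite mulr1 in ay ya; rewrite scale1r in ax xa.
set q := (r ^+ (2 ^ m))%:C *: bm in ay ya.
have q8 : rnorm q <= 8^-1.
  by rewrite rnormZ nbm mulr1 ger0_norm // exprn_ge0.
have y1 : y - one = q ** y.
  by apply/eqP; rewrite subr_eq addrC -subr_eq -{1}[y]amul1l -amulBl ay.
have x1e : x - one = bm ** x.
  by apply/eqP; rewrite subr_eq addrC -subr_eq -{1}[x]amul1l -amulBl ax.
have yb : rnorm (y - one) <= 8^-1 * rnorm y by rewrite y1; exact: rnormM_le.
have yc : rnorm y <= rnorm (y - one) + 1.
  by rewrite -{1}[y](subrK one); apply: le_trans (rnormD _ _) _;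
    rewrite lerD2l rnorm1_le.
(* From [|y - 1| <= |y| / 8] follows [|y - 1| <= 1/7], and [1/8 + 1/7 < 1/3]. Then
   [bm = (bm x) (1 - bm)] has norm at most [2/3], against [nbm]. *)
have xc : rnorm (bm ** x) <= 3^-1.
  rewrite -x1e -[x](subrK y) -addrA; have := rnormD (x - y) (y - one); lra.
have : rnorm (bm ** x ** (one - bm)) <= 3^-1 * 2.
  apply: rnormM_le => //; have := rnormB one bm; have := rnorm1_le A; lra.
rewrite -amulA xa amul1r nbm; lra.
Qed.

Lemma spectrum_rnorm b : star b = b -> 0 < rnorm b ->
  spectrum b (rnorm b)%:C \/ spectrum b (- rnorm b)%:C.
Proof.
move=> sb b0; apply: contrapT => /not_orP[/contrapT [x1 ix1] /contrapT [x2
  ix2]].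
set r := rnorm b in ix1 ix2 b0.
have rC : r^-1%:C != 0 :> R[i]
  by rewrite eq_complex /= eqxx andbT invr_eq0 gt_eqF.
have one_r : r^-1%:C *: (r%:C *: one) = one.
  by rewrite scalerA -rmorphM /= mulVf ?gt_eqF // scale1r.
have := inverse_scale rC ix1; rewrite scalerBr one_r => i1.
have rC' : - r^-1%:C != 0 :> R[i] by rewrite oppr_eq0.
have := inverse_scale rC' ix2;
  rewrite rmorphN /= scalerBr scalerA mulrNN -scalerA.
rewrite one_r scaleNr opprK => i2.
apply: (rnorm1_not_inverse _ _ i1 i2); first by rewrite starZr sb.
by rewrite rnormZ gtr0_norm ?invr_gt0 // mulVf // gt_eqF.
Qed.

End spectral_radius.

(** * The positive cone of the algebra *)

Section positivity.
Context (R : realType) (A : cstarAlgType R).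
Implicit Types (a b c h p q x y : A) (l z w : R[i]) (r s t : R).

Local Notation cmod l := (complex.Re `|l|).
Local Notation one := (aone : A).

Lemma spectrum_shift x l t :
  spectrum (t%:C *: one - x) l -> spectrum x (t%:C - l).
Proof.
move=> sl [y iy]; apply: sl; exists ((-1)^-1 *: y).
have -> : l *: one - (t%:C *: one - x) = -1 *: ((t%:C - l) *: one - x).
  by rewrite scaleN1r scalerBl !opprB addrCA.
by apply: inverse_scale iy; rewrite oppr_eq0 oner_eq0.
Qed.

Lemma spectrum_shiftN x l t :
  spectrum x l -> spectrum (t%:C *: one - x) (t%:C - l).
Proof. by move=> sl; apply: spectrum_shift; rewrite subKr. Qed.

(** For [b = t - x], one of [t - |b|] and [t + |b|] is in the spectrum of [x]: the first is
    nonnegative by positivity, and the second is at most [|x| <= t] by the spectral bound. *)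
Lemma cstar_pos_shift_le x t : cstar_pos x -> rnorm x <= t ->
  rnorm (t%:C *: one - x) <= t.
Proof.
move=> [sx px] xt; set b := _ - x.
have sb : star b = b by rewrite starB starZr star1 sx.
have t0 : 0 <= t := le_trans (rnorm_ge0 x) xt.
have := rnorm_ge0 b; rewrite le_eqVlt => /orP[/eqP <- //|b0].
case: (spectrum_rnorm sb b0) => /spectrum_shift sl.
  by have := px _ sl; rewrite -rmorphB ler0c subr_ge0.
have := spectrum_norm sl;
  rewrite -rmorphB opprK cmodR ger0_norm ?addr_ge0 ?rnorm_ge0 //.
lra.
Qed.

Lemma shift_le_cstar_pos x t : star x = x -> rnorm (t%:C *: one - x) <= t ->
  cstar_pos x.
Proof.
move=> sx xt; split=> // l sl.
have il := spectrum_sa_real sx sl.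
have le : l = (complex.Re l)%:C by case: (l) il => a b /= ->.
rewrite le ler0c; move/spectrum_norm: (spectrum_shiftN (t := t) sl).
rewrite {1}le -rmorphB cmodR => /le_trans /(_ xt).
by rewrite ler_norml => /andP[_]; rewrite lerBlDr lerDl.
Qed.

(** With [t = |x| + |y|], the norm criterion for positivity reduces to the triangle inequality. *)
Lemma cstar_posD x y : cstar_pos x -> cstar_pos y -> cstar_pos (x + y).
Proof.
move=> px py; apply: (@shift_le_cstar_pos _ (rnorm x + rnorm y)).
  by rewrite starD px.1 py.1.
rewrite rmorphD scalerDl opprD addrACA; apply: le_trans (rnormD _ _) _.
by apply: lerD; exact: cstar_pos_shift_le.
Qed.

Lemma cstar_posZ r x : 0 <= r -> cstar_pos x -> cstar_pos (r%:C *: x).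
Proof.
move=> r0 px; apply: (@shift_le_cstar_pos _ (r * rnorm x)).
  by rewrite starZr px.1.
rewrite rmorphM -scalerA -scalerBr rnormZ ger0_norm // ler_wpM2l //.
exact: cstar_pos_shift_le.
Qed.

Lemma cstar_pos0 : cstar_pos (0 : A).
Proof. by apply: (@shift_le_cstar_pos _ 0);
  rewrite ?star0 // scale0r subrr rnorm0. Qed.

Lemma cstar_pos_sum (I : Type) (s : seq I) (P : pred I) (F : I -> A) :
  (forall i, P i -> cstar_pos (F i)) -> cstar_pos (\sum_(i <- s | P i) F i).
Proof. by move=> H; apply: big_ind => //;
  [exact: cstar_pos0|exact: cstar_posD]. Qed.

(** Both self-adjointness and the norm criterion [|t - x| <= t] survive norm limits. *)
Lemma cstar_pos_closed x :
  (forall e : R, 0 < e -> exists2 y, cstar_pos y & rnorm (x - y) <= e) ->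
    cstar_pos x.
Proof.
move=> H; apply: (@shift_le_cstar_pos _ (rnorm x)).
  apply/eqP; rewrite -subr_eq0; apply/eqP/rnorm_eq0/le_anti.
  rewrite rnorm_ge0 andbT; apply/ler_addgt0Pl => e e0; rewrite addr0.
  have [|y [sy _] xy] := H (e / 2); first by rewrite divr_gt0.
  have -> : star x - x = star (x - y) - (x - y)
    by rewrite starB sy opprB addrA subrK.
  by have := rnormB (star (x - y)) (x - y); rewrite rnorm_star; lra.
apply/ler_addgt0Pl => e e0.
have [|y py xy] := H (e / 3); first by rewrite divr_gt0.
have yx : rnorm y <= rnorm x + e / 3.
  by rewrite -[y](subrK x); have := rnormD (y - x) x; rewrite rnorm_distC; lra.
have := cstar_pos_shift_le py yx; set t := rnorm x + e / 3.
have -> : (rnorm x)%:C *: one - x = (t%:C *: one - y) - ((e / 3)%:C *: one + (x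
  - y)).
  by rewrite /t rmorphD /= scalerDl opprD opprB [RHS]addrACA addrK addKr.
have := rnormB (t%:C *: one - y) ((e / 3)%:C *: one + (x - y)).
have := rnormD ((e / 3)%:C *: one) (x - y).
rewrite rnormZ ger0_norm ?divr_ge0 ?(ltW e0) //.
have : e / 3 * rnorm one <= e / 3
  by rewrite ler_piMr ?rnorm1_le // divr_ge0 ?(ltW e0).
rewrite /t; lra.
Qed.

Lemma cstar_pos_rnorm_sub p : star p = p -> cstar_pos ((rnorm p)%:C *: one - p).
Proof.
move=> sp; apply: (@shift_le_cstar_pos _ (rnorm p)).
  by rewrite starB starZr star1 sp.
by rewrite opprB addrCA subrr addr0.
Qed.

(** As [p <= |p|], both [|p| - x] and [|p| + x] are positive, and the spectrum of one of them
    contains [|p| - |x|]. *)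
Lemma rnorm_le_sandwich p x : star x = x ->
  cstar_pos (p - x) -> cstar_pos (p + x) -> rnorm x <= rnorm p.
Proof.
move=> sx p1 p2.
have sp : star p = p by have := p1.1; rewrite starB sx => /addIr.
have := rnorm_ge0 x; rewrite le_eqVlt => /orP[/eqP <- //|x0];
  first exact: rnorm_ge0.
have pp := cstar_pos_rnorm_sub sp.
have q1 := cstar_posD pp p1; rewrite addrA subrK in q1.
have q2 := cstar_posD pp p2; rewrite addrA subrK in q2.
case: (spectrum_rnorm sx x0) => sl.
  by have := q1.2 _ (spectrum_shiftN (t := rnorm p) sl);
    rewrite -rmorphB ler0c subr_ge0.
rewrite -[x]opprK in q2; have sl' : spectrum (- x) (rnorm x)%:C.
  have := spectrum_shiftN (t := 0) sl.
  by rewrite rmorph0 scale0r !sub0r rmorphN opprK.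
by have := q2.2 _ (spectrum_shiftN (t := rnorm p) sl');
  rewrite -rmorphB ler0c subr_ge0.
Qed.

Lemma rnorm_le p q : cstar_pos p -> cstar_pos (q - p) -> rnorm p <= rnorm q.
Proof.
move=> pp qp; apply: rnorm_le_sandwich => //; first exact: pp.1.
rewrite -[q](subrK p) -addrA.
by apply: cstar_posD => //; apply: cstar_posD.
Qed.

(** [2 x = u - i v] with [u = x + x^*] and [v = i x - i x^*] self-adjoint, each bounded in norm by
    [|p|] by the sandwich. *)
Lemma rnorm_le_cross p x :
  cstar_pos (p + (x + star x)) -> cstar_pos (p - (x + star x)) ->
  cstar_pos (p + ('i *: x - 'i *: star x)) ->
  cstar_pos (p - ('i *: x - 'i *: star x)) -> rnorm x <= rnorm p.
Proof.
move=> p1 p2 p3 p4.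
have su : star (x + star x) = x + star x by rewrite starD starK addrC.
have conj_i : Num.conj 'i = - 'i :> R[i]
  by rewrite conjE /= -[RHS]/(- 0 +i* - 1) oppr0.
have sv : star ('i *: x - 'i *: star x) = 'i *: x - 'i *: star x.
  by rewrite starB !starZ starK conj_i !scaleNr opprK addrC.
have ux := rnorm_le_sandwich su p2 p1.
have vx := rnorm_le_sandwich sv p4 p3.
set u := x + star x in ux; set v := 'i *: x - _ in vx.
have i1 : cmod ('i : R[i]) = 1.
  by rewrite normc_def /= expr0n add0r expr1n sqrtr1.
have e : 2%:C *: x = u - 'i *: v.
  rewrite /u /v scalerBr !scalerA -expr2 sqr_i !scaleN1r opprB opprK.
  rewrite addrA addrK -{2 3}[x]scale1r -scalerDl.
  by congr (_ *: _); rewrite -[2]/(1 + 1) rmorphD rmorph1.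
have : rnorm (2%:C *: x) <= 2 * rnorm p.
  rewrite e; apply: le_trans (rnormB _ _) _.
  by rewrite rnormZc i1; lra.
by rewrite rnormZ ger0_norm //; lra.
Qed.

End positivity.

(** * Inner products and positive operators *)

Section inner_product.
Context (R : realType) (A : cstarAlgType R).

(** The values 1, -1, [i] and [-i] of [w] give the hypotheses of [rnorm_le_cross]. In this form the
    hypothesis is what expanding a positive form at [f + w g] provides. *)
Lemma rnorm_le_form (p x : A) :
  (forall w : R[i], w * conjc w = 1 ->
    cstar_pos (p + (conjc w *: x + w *: star x))) ->
  rnorm x <= rnorm p.
Proof.
move=> H.
have conj_i : conjc 'i = - 'i :> R[i] by rewrite /= -[RHS]/(- 0 +i* - 1) oppr0.
have conjN (l : R[i]) : conjc (- l) = - conjc l by exact: rmorphN.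
have conj_1 : conjc 1 = 1 :> R[i] by exact: rmorph1.
apply: rnorm_le_cross.
- by have := H 1; rewrite conj_1 mulr1 !scale1r; apply.
- have := H (-1); rewrite conjN conj_1 mulrNN mulr1 !scaleN1r -opprD; exact.
- have := H (- 'i); rewrite conjN conj_i opprK mulNr -expr2 sqr_i opprK scaleNr.
  exact.
- have := H 'i; rewrite conj_i mulrN -expr2 sqr_i opprK scaleNr opprB.
  by rewrite [- _ + _]addrC; exact.
Qed.

Context (H : hilbertModType A).
Implicit Types (f g h : H) (l : R[i]) (r : R).

Lemma inner_scale l f g : inner (l *: f) g = l *: inner f g.
Proof. by rewrite scale_act inner_actl amulZl amul1l. Qed.

Lemma innerDr f g h : inner f (g + h) = inner f g + inner f h.
Proof. by rewrite -inner_star innerDl starD !inner_star. Qed.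

Lemma inner_scaler l f g : inner f (l *: g) = conjc l *: inner f g.
Proof. by rewrite -inner_star inner_scale starZ inner_star. Qed.

Lemma innerNl f g : inner (- f) g = - inner f g.
Proof. by rewrite -scaleN1r inner_scale scaleN1r. Qed.

Lemma innerNr f g : inner f (- g) = - inner f g.
Proof. by rewrite -inner_star innerNl starN inner_star. Qed.

Lemma innerBl f g h : inner (f - g) h = inner f h - inner g h.
Proof. by rewrite innerDl innerNl. Qed.

Lemma innerBr f g h : inner f (g - h) = inner f g - inner f h.
Proof. by rewrite innerDr innerNr. Qed.

Lemma inner0l f : inner 0 f = 0.
Proof. by rewrite -(scale0r f) inner_scale scale0r. Qed.

Lemma inner_suml (I : Type) (s : seq I) (P : pred I) (F : I -> H) g :
  inner (\sum_(i <- s | P i) F i) g = \sum_(i <- s | P i) inner (F i) g.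
Proof. by elim/big_rec2: _ => [|i x y _ <-]; rewrite ?inner0l ?innerDl. Qed.

Lemma rnorm_sqr f : rnorm f ^+ 2 = rnorm (inner f f).
Proof.
by apply: complexI; rewrite rmorphXn /= -!rnormE norm_inner sqrtCK.
Qed.

Lemma inner_ext f g : (forall h, inner f h = inner g h) -> f = g.
Proof.
move=> fg; apply/eqP; rewrite -subr_eq0; apply/eqP/inner_eq0.
by rewrite innerBl fg subrr.
Qed.

Lemma inner_expand l f g : inner (f + l *: g) (f + l *: g) =
  inner f f + (l * conjc l) *: inner g g +
  (conjc l *: inner f g + l *: star (inner f g)).
Proof.
rewrite innerDl !innerDr !inner_scale !inner_scaler scalerA inner_star.
by rewrite [RHS]addrACA [_ + l *: _]addrC.
Qed.

End inner_product.

(** * Cauchy-Schwarz inequalities *)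

Section cauchy_schwarz.
Context (R : realType) (A : cstarAlgType R).

(** Expand [<x_i + w y_i, x_i + w y_i> >= 0] for [|w| = 1] and sum over [i]. The bound is additive;
    rescaling one family against the other recovers sharper estimates. *)
Lemma rnorm_inner_sum (I : choiceType) (s : seq I) (K : I -> hilbertModType A)
    (x y : forall i, K i) :
  rnorm (\sum_(i <- s) inner (x i) (y i)) <=
  rnorm (\sum_(i <- s) inner (x i) (x i) + \sum_(i <- s) inner (y i) (y i)).
Proof.
apply: rnorm_le_form => w w1.
rewrite (big_morph (fun a : A => star a) (@starD R A) (@star0 R A)).
rewrite !scaler_sumr -!big_split /=.
apply: cstar_pos_sum => i _.
by have := inner_pos (x i + w *: y i); rewrite inner_expand w1 scale1r.
Qed.

(** Scaling [f] by [|g|] and [g] by [|f|] gives both the norm [|f| |g|], so the additive bound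
    becomes a product with constant 2. *)
Lemma rnorm_inner (H : hilbertModType A) (f g : H) :
  rnorm (inner f g) <= 2 * (rnorm f * rnorm g).
Proof.
have aux (u v : H) : rnorm (inner u v) <= rnorm u ^+ 2 + rnorm v ^+ 2.
  have := @rnorm_inner_sum unit [:: tt] (fun=> H) (fun=> u) (fun=> v).
  rewrite !big_seq1 => /le_trans; apply.
  by rewrite !rnorm_sqr; exact: rnormD.
have := rnorm_ge0 f; rewrite le_eqVlt => /orP[/eqP f0|f0].
  by rewrite (rnorm_eq0 (esym f0)) inner0l !rnorm0 mul0r mulr0.
have := rnorm_ge0 g; rewrite le_eqVlt => /orP[/eqP g0|g0].
  by rewrite (rnorm_eq0 (esym g0)) -inner_star inner0l star0 !rnorm0 !mulr0.
have := aux ((rnorm g)%:C *: f) ((rnorm f)%:C *: g).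
rewrite inner_scale inner_scaler conjc_real !rnormZ !ger0_norm ?rnorm_ge0 //.
have := mulr_gt0 f0 g0; set u := rnorm f in f0 *;
  set v := rnorm g in g0 * => uv.
by move=> le; rewrite -(ler_pM2l uv) -mulrA mulrCA; apply: le_trans le _; nra.
Qed.

End cauchy_schwarz.

(** * Symmetric and positive operators, and order bounds for commuting products *)

Section positive_operators.
Context (R : realType) (A : cstarAlgType R) (H : hilbertModType A).
Implicit Types (f g h : H) (G T : H -> H) (K r : R).

Definition form_symmetric T := forall f g, inner (T f) g = inner f (T g).
Definition form_pos T := forall f, cstar_pos (inner (T f) f).
Definition bounded_by T K := forall f, rnorm (T f) <= K * rnorm f.
Definition commuting G T := forall f, G (T f) = T (G f).

(** Symmetry alone forces linearity, since inner products separate points; operators can therefore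
    be plain functions. *)
Lemma form_symmetricD T : form_symmetric T -> {morph T : f g / f + g}.
Proof.
by move=> sT f g; apply: inner_ext => h; rewrite innerDl !sT innerDl.
Qed.

Lemma form_symmetricZ T l : form_symmetric T -> {morph T : f / l *: f}.
Proof.
by move=> sT f; apply: inner_ext => h; rewrite inner_scale !sT inner_scale.
Qed.

Lemma form_symmetricB T : form_symmetric T -> {morph T : f g / f - g}.
Proof.
by move=> sT f g; rewrite form_symmetricD // -scaleN1r form_symmetricZ //
  scaleN1r.
Qed.

Lemma form_symmetric_comp G T : form_symmetric G -> form_symmetric T ->
  commuting G T ->
  form_symmetric (G \o T).
Proof. by move=> sG sT cGT f g /=; rewrite sG sT cGT. Qed.

(** Polarization: [<T h, h>] is self-adjoint at [h = f + w g], which gives [conj w * d = w * d^*]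
    for the defect [d]. Taking [w = 1] and [w = i] forces [d = 0]. *)
Lemma form_pos_symmetric (T : {linear H -> H}) : form_pos T -> form_symmetric T.
Proof.
move=> pT f g; apply/subr0_eq; set d := _ - _.
have E w : conjc w *: d = w *: star d.
  set x := inner (T f) g in d *; set y := inner f (T g) in d *.
  pose S := conjc w *: x + w *: star y.
  have eS : inner (T (f + w *: g)) (f + w *: g) =
      inner (T f) f + (w * conjc w) *: inner (T g) g + S.
    rewrite linearD linearZ /= innerDl !innerDr !inner_scale !inner_scaler
      scalerA.
    by rewrite [RHS]addrACA [_ + w *: _]addrC /S /y inner_star.
  have sww : Num.conj (w * conjc w) = w * conjc w.
    by rewrite rmorphM /= !conjE conjcK mulrC.
  have sS : star S = S.
    apply: (addrI (inner (T f) f + (w * conjc w) *: inner (T g) g)).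
    rewrite -eS -[RHS](pT _).1 eS [RHS]starD [in RHS]starD starZ sww.
    by rewrite (pT f).1 (pT g).1.
  move: sS; rewrite /S starD !starZ starK !conjE conjcK => sS.
  apply/eqP; rewrite starB !scalerBr subr_eq addrAC eq_sym subr_eq; apply/eqP.
  by rewrite sS.
have conj_i : conjc 'i = - 'i :> R[i] by rewrite /= -[RHS]/(- 0 +i* - 1) oppr0.
have e1 : d = star d.
  by have := E 1; rewrite (_ : conjc 1 = 1) ?scale1r //; exact: rmorph1.
have := E 'i; rewrite conj_i -e1 scaleNr => /eqP;
  rewrite eq_sym -addr_eq0 -scalerDl.
rewrite scaler_eq0 => /orP[|/eqP //].
by rewrite -mulr2n mulrn_eq0 /= eq_complex /= oner_eq0 andbF.
Qed.

(* For the semi-inner product [u, v] = <G u, v>, on which [T] is symmetric,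
   0 <= [f - Tf, f - Tf] reads 2 [Tf, f] <= [f, f] + [T^2 f, f]; iterating with
   T^2, T^4, ... leaves a remainder of size 2^-n. *)
Lemma form_contraction_le G T : form_symmetric G -> form_pos G ->
  form_symmetric T ->
  commuting G T -> bounded_by T 1 ->
  forall f, cstar_pos (inner (G f) f - inner (G (T f)) f).
Proof.
move=> sG pG sT cGT T1 f.
(* [E] bounds the defect for every contraction commuting with [G], so the same bound serves for all
   the powers [T^2], [T^4], and so on. *)
pose E := 4 * (rnorm (G f) * rnorm f).
have step n : exists2 e, rnorm e <= E &
    cstar_pos ((2 ^+ n)%:C *: (inner (G f) f - inner (G (T f)) f) + e).
  elim: n T sT cGT T1 => [|n IH] T sT cGT T1.
    exists (- (inner (G f) f - inner (G (T f)) f)).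
      rewrite rnormN; apply: le_trans (rnormB _ _) _.
      rewrite [inner (G (T f)) f]sG; have := rnorm_inner (G f) f;
        have := rnorm_inner (T f) (G f).
      have := T1 f; rewrite mul1r => Tf.
      have := ler_wpM2r (rnorm_ge0 (G f)) Tf; rewrite /E; lra.
    by rewrite expr0 scale1r subrr; exact: cstar_pos0.
  have TT1 : bounded_by (T \o T) 1.
    by move=> g; apply: le_trans (T1 (T g)) _; rewrite mul1r; exact: T1.
  have cGTT : commuting G (T \o T) by move=> g /=; rewrite !cGT.
  have [e eE pe] := IH (T \o T) (form_symmetric_comp sT sT (fun=> erefl)) cGTT
    TT1.
  exists e => //=.
  have := cstar_posD pe (cstar_posZ (exprn_ge0 n (ler0n R 2)) (pG (f - T f))).
  have -> : inner (G (f - T f)) (f - T f) = (inner (G f) f - inner (G (T f)) f)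
    -
      (inner (G (T f)) f - inner (G (T (T f))) f).
    by rewrite form_symmetricB // innerBl !innerBr -!sT -!cGT.
  move: (inner (G f) f) (inner (G (T f)) f) (inner (G (T (T f))) f) => a c b.
  rewrite addrAC -scalerDr opprB addrACA addKr [a + _ - c]addrAC.
  by rewrite -mulr2n -[(a - c) *+ 2]scaler_nat scalerA exprSr rmorphM
    rmorph_nat addrC.
apply: cstar_pos_closed => e e0.
have [n nE] : exists n, 2^-1 ^+ n * E <= e.
  have E0 : 0 <= E by rewrite mulr_ge0 // mulr_ge0 // rnorm_ge0.
  have h1 : `|2^-1 : R| < 1 by rewrite ger0_norm //; lra.
  have d0 : 0 < e / (E + 1) by rewrite divr_gt0 //; lra.
  have /cvgrPdist_lt /(_ _ d0) [N _ HN] := cvg_expr h1; exists N.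
  have /= := HN N (leqnn N); rewrite sub0r normrN ger0_norm ?exprn_ge0 //.
  rewrite ltr_pdivlMr; last lra.
  by have : 0 <= (2^-1 : R) ^+ N by []; nra.
have [u uE pu] := step n.
pose v := (2^-1 ^+ n)%:C *: u.
exists (inner (G f) f - inner (G (T f)) f + v).
  have := cstar_posZ (exprn_ge0 n (_ : 0 <= 2^-1 :> R)) pu;
    rewrite scalerDr scalerA.
  by rewrite -rmorphM /= -exprMn mulVf // expr1n scale1r; apply;
    rewrite invr_ge0.
rewrite opprD addrA subrr sub0r rnormN rnormZ ger0_norm ?exprn_ge0 //.
by apply: le_trans nE; rewrite ler_wpM2l // exprn_ge0.
Qed.

Lemma form_mul_le G T K : form_symmetric G -> form_pos G -> form_symmetric T ->
  commuting G T -> 0 < K -> bounded_by T K ->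
  forall f, cstar_pos (K%:C *: inner (G f) f - inner (G (T f)) f).
Proof.
move=> sG pG sT cGT K0 TK f.
pose T' g := K^-1%:C *: T g.
have sT' : form_symmetric T'.
  by move=> g h; rewrite inner_scale inner_scaler conjc_real sT.
have cGT' : commuting G T' by move=> g; rewrite form_symmetricZ // cGT.
have T1 : bounded_by T' 1.
  by move=> g; rewrite rnormZ gtr0_norm ?invr_gt0 // mul1r ler_pdivrMl.
have := cstar_posZ (ltW K0) (form_contraction_le sG pG sT' cGT' T1 f).
rewrite scalerBr form_symmetricZ // inner_scale scalerA -rmorphM /=.
by rewrite mulfV ?gt_eqF // scale1r.
Qed.

(** Apply [form_mul_le] to [V = K - T]: the difference [K <G f, f> - <G V f, f>] is exactly
    [<G T f, f>]. That [V] is bounded by [K] comes from [V^2 <= K^2], as [T >= 0] and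
    [T^2 <= K T]. *)
Lemma form_pos_mul G T K : form_symmetric G -> form_pos G ->
  form_symmetric T -> form_pos T ->
  commuting G T -> 0 < K -> bounded_by T K -> form_pos (G \o T).
Proof.
move=> sG pG sT pT cGT K0 TK f.
pose V g := K%:C *: g - T g.
have sV : form_symmetric V.
  by move=> g h; rewrite innerBl innerBr inner_scale inner_scaler conjc_real sT.
have cGV : commuting G V by move=> g;
  rewrite form_symmetricB // form_symmetricZ // cGT.
have VK : bounded_by V K.
  move=> g; have K0' := ltW K0.
  rewrite -(ler_pXn2r (n := 2)) ?nnegrE ?mulr_ge0 ?rnorm_ge0 //.
  rewrite exprMn !rnorm_sqr; have -> : K ^+ 2 * rnorm (inner g g) =
      rnorm ((K ^+ 2)%:C *: inner g g) by rewrite rnormZ ger0_norm ?sqr_ge0.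
  apply: rnorm_le; first exact: inner_pos.
  have e : inner (V g) (V g) = (K ^+ 2)%:C *: inner g g - K%:C *: inner (T g) g
    -
     (K%:C *: inner (T g) g - inner (T (T g)) g).
    rewrite innerBl !innerBr !inner_scale !inner_scaler !conjc_real scalerA.
    by rewrite -rmorphM -expr2 -!sT.
  have := cstar_posD (cstar_posZ (ltW K0) (pT g))
    (form_mul_le sT pT sT (fun=> erefl) K0 TK g).
  rewrite e; set X := _ *: inner g g; set Y := _ *: inner (T g) g;
    move: (Y - _) => Z.
  by rewrite [- (X - Y - Z)]opprB addrCA subKr addrC.
have := form_mul_le sG pG sV cGV K0 VK f.
by rewrite /V form_symmetricB // form_symmetricZ //
  innerBl inner_scale opprB addrCA subrr addr0.
Qed.

(** This is [form_mul_le] for the positive operator [G T] and the multiplier [D = T^-1]. *)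
Lemma form_mul_inverse_le G T D L K : form_symmetric G -> form_pos G ->
  form_symmetric T -> form_pos T -> commuting G T -> 0 < L -> bounded_by T L ->
  cancel T D -> cancel D T -> 0 < K -> bounded_by D K ->
  forall f, cstar_pos (K%:C *: inner (G (T f)) f - inner (G f) f).
Proof.
move=> sG pG sT pT cGT L0 TL TD DT K0 DK f.
have sGT : form_symmetric (G \o T) := form_symmetric_comp sG sT cGT.
have pGT := form_pos_mul sG pG sT pT cGT L0 TL.
have sD : form_symmetric D by move=> g h; rewrite -[h in LHS]DT -sT DT.
have cGTD : commuting (G \o T) D.
  by move=> g /=; rewrite DT cGT TD.
by have := form_mul_le sGT pGT sD cGTD K0 DK f; rewrite /= DT.
Qed.

End positive_operators.

(** * Unordered sums and the frame operator *)

#[local] Existing Instance summability.totally_filter.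

Section net_sums.
Context (R : realType) (V : completeNormedModType R[i]) (J : choiceType).
Implicit Types (u : J -> V) (B F : {fset J}).

Lemma partial_sumE u B : summability.partial_sum u B = \sum_(j <- B) u j.
Proof. by rewrite /summability.partial_sum big_seq_fsetE. Qed.

Lemma net_summable_approx u : net_summable u ->
  forall e : R, 0 < e -> exists F, forall B, (F `<=` B)%fset ->
    rnorm (summability.sum u - \sum_(j <- B) u j) <= e.
Proof.
move=> su e e0; have eC : 0 < e%:C by rewrite ltcR.
move/cvgrPdist_le : su => /(_ _ eC) [F _ HF]; exists F => B FB.
by have := HF B FB; rewrite /= rnormE lecR partial_sumE.
Qed.

Lemma sum_fsetD u F B : (F `<=` B)%fset ->
  \sum_(j <- B) u j - \sum_(j <- F) u j = \sum_(j <- (B `\` F)%fset) u j.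
Proof.
move=> FB; rewrite (big_fsetID _ (mem F)) /=.
have -> : [fset x in B | mem F x]%fset = F.
  apply/fsetP => x; rewrite !inE /=.
  by apply/andP/idP => [[]//|xF]; split=> //; apply: (fsubsetP FB).
rewrite addrAC subrr add0r; apply: eq_fbigl => x.
by rewrite !inE /= andbC.
Qed.

Lemma net_summable_cauchy u :
  (forall e : R, 0 < e -> exists F, forall B, (F `<=` B)%fset ->
    rnorm (\sum_(j <- (B `\` F)%fset) u j) <= e) -> net_summable u.
Proof.
move=> H.
have FF : ProperFilter (summability.partial_sum u @ summability.totally).
  exact: fmap_proper_filter.
apply: cauchy_cvg; apply/cauchy_ballP => e e0.
have e'0 : 0 < complex.Re e by move: e0; rewrite ltcE /= => /andP[].
have [|F HF] := H (complex.Re e / 3); first by rewrite divr_gt0.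
exists ([set summability.partial_sum u B | B in [set B | (F `<=` B)%fset]],
        [set summability.partial_sum u B | B in [set B | (F `<=` B)%fset]]).
  by split=> /=; exists F => // B FB; exists B.
move=> [_ _] /= [[B FB <-] [B' FB' <-]].
rewrite -ball_normE /= rnormE !partial_sumE -(RRe_real (gtr0_real e0)) ltcR.
have -> : \sum_(j <- B) u j - \sum_(j <- B') u j =
    (\sum_(j <- B) u j - \sum_(j <- F) u j) - (\sum_(j <- B') u j - \sum_(j <-
      F) u j).
  by rewrite opprB addrA subrK.
rewrite (sum_fsetD u FB) (sum_fsetD u FB').
have := rnormB (\sum_(j <- (B `\` F)%fset) u j) (\sum_(j <- (B' `\` F)%fset) u
  j).
have := HF B FB; have := HF B' FB'; lra.
Qed.

Lemma rnorm_approx_eq (x y : V) : (forall e : R, 0 < e ->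
  rnorm (x - y) <= e) -> x = y.
Proof.
move=> H; apply/subr0_eq/rnorm_eq0/le_anti; rewrite rnorm_ge0 andbT.
by apply/ler_addgt0Pl => e e0; rewrite addr0; exact: H.
Qed.

Lemma net_sum_unique u x : net_summable u ->
  (forall e : R, 0 < e -> exists F, forall B, (F `<=` B)%fset ->
    rnorm (x - \sum_(j <- B) u j) <= e) -> x = summability.sum u.
Proof.
move=> su xu; apply: rnorm_approx_eq => e e0.
have e2 : 0 < e / 2 by rewrite divr_gt0.
have [F HF] := net_summable_approx su e2; have [F' HF'] := xu _ e2.
pose B := (F `|` F')%fset.
have := HF B (fsubsetUl _ _); have := HF' B (fsubsetUr _ _).
have -> : x - summability.sum u =
    (x - \sum_(j <- B) u j) - (summability.sum u - \sum_(j <- B) u j).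
  by rewrite opprB addrA subrK.
have := rnormB (x - \sum_(j <- B) u j) (summability.sum u - \sum_(j <- B) u j).
lra.
Qed.

Lemma net_summable_tail u : net_summable u ->
  forall e : R, 0 < e -> exists F, forall B, (F `<=` B)%fset ->
    rnorm (\sum_(j <- (B `\` F)%fset) u j) <= e.
Proof.
move=> su e e0; have e2 : 0 < e / 2 by rewrite divr_gt0.
have [F HF] := net_summable_approx su e2; exists F => B FB.
rewrite -sum_fsetD //.
have -> : \sum_(j <- B) u j - \sum_(j <- F) u j =
    (summability.sum u - \sum_(j <- F) u j) - (summability.sum u - \sum_(j <-
      B) u j).
  by rewrite opprB addrCA addrAC subrr add0r.
have := rnormB (summability.sum u - \sum_(j <- F) u j)
  (summability.sum u - \sum_(j <- B) u j).
have := HF B FB; have := HF F (fsubset_refl F); lra.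
Qed.

End net_sums.

Section positive_net_sums.
Context (R : realType) (A : cstarAlgType R) (J : choiceType).
Implicit Types (u : J -> A) (B F : {fset J}).

Lemma partial_sum_le u B : (forall j, cstar_pos (u j)) -> net_summable u ->
  cstar_pos (summability.sum u - \sum_(j <- B) u j).
Proof.
move=> pu su; apply: cstar_pos_closed => e e0.
have [F HF] := net_summable_approx su e0.
exists (\sum_(j <- (F `|` B)%fset) u j - \sum_(j <- B) u j).
  by rewrite sum_fsetD ?fsubsetUr //; exact: cstar_pos_sum.
by rewrite opprB addrA subrK; exact: HF (fsubsetUl _ _).
Qed.

Lemma net_sum_pos u : (forall j, cstar_pos (u j)) -> net_summable u ->
  cstar_pos (summability.sum u).
Proof.
by move=> pu su; have := @partial_sum_le _ fset0 pu su;
  rewrite big_seq_fset0 subr0.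
Qed.

End positive_net_sums.

(** * Strong convergence of order-bounded sums of positive operators *)

Section frame_operator.
Context (R : realType) (A : cstarAlgType R) (H : hilbertModType A).
Implicit Types (f g h : H) (T : H -> H).

Lemma form_cauchy_schwarz T f g : form_symmetric T -> form_pos T ->
  rnorm (inner (T f) g) <= rnorm (inner (T f) f + inner (T g) g).
Proof.
move=> sT pT; apply: rnorm_le_form => w w1.
have := pT (f + w *: g);
  rewrite form_symmetricD // form_symmetricZ // innerDl !innerDr.
rewrite !inner_scale !inner_scaler scalerA w1 scale1r inner_star -sT.
by rewrite [_ + inner (T g) g]addrC addrACA.
Qed.

Lemma form_le_rnorm T b f : form_pos T -> 0 <= b ->
  cstar_pos (b%:C *: inner f f - inner (T f) f) ->
  rnorm (inner (T f) f) <= b * rnorm f ^+ 2.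
Proof.
move=> pT b0 bT; rewrite rnorm_sqr -{1}(ger0_norm b0) -rnormZ.
exact: rnorm_le.
Qed.

(** In Cauchy-Schwarz take [g = s T f] with [s = 1 / (2 b)]: the term [b s^2 |T f|^2] is half of the
    left side [s |T f|^2] and is absorbed. *)
Lemma form_le_bounded T b : form_symmetric T -> form_pos T -> 0 < b ->
  (forall f, cstar_pos (b%:C *: inner f f - inner (T f) f)) ->
    bounded_by T (2 * b).
Proof.
move=> sT pT b0 bT f.
pose s := (2 * b)^-1; have s0 : 0 < s by rewrite invr_gt0 mulr_gt0.
have sb : s * b = 2^-1 by rewrite /s; field; rewrite gt_eqF.
have b2 : 0 <= 2 * b by rewrite mulr_ge0 // ltW.
rewrite -(ler_pXn2r (n := 2)) ?nnegrE ?mulr_ge0 ?rnorm_ge0 ?(ltW b0) //.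
have := form_cauchy_schwarz f (s%:C *: T f) sT pT.
rewrite inner_scaler conjc_real rnormZ gtr0_norm // -rnorm_sqr.
have := form_le_rnorm pT (ltW b0) (bT f).
have := form_le_rnorm pT (ltW b0) (bT (s%:C *: T f)).
rewrite rnormZ gtr0_norm //.
have := rnormD (inner (T f) f) (inner (T (s%:C *: T f)) (s%:C *: T f)).
have := rnorm_ge0 f; have := rnorm_ge0 (T f).
move: (rnorm (inner _ _ + _)) => x; move: (rnorm (inner (T f) f)) => y.
move: (rnorm (inner _ _)) => z;
  move: (rnorm f) (rnorm (T f)) => m n n0 m0 H1 H2 H3 H4.
have : s * n ^+ 2 <= b * m ^+ 2 + b * (s * n) ^+ 2 by lra.
have -> : b * (s * n) ^+ 2 = s * n ^+ 2 * (s * b) by ring.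
rewrite sb => H5; have : s * n ^+ 2 * b <= 2 * b * m ^+ 2 * b
  by rewrite ler_pM2r //; lra.
have -> : s * n ^+ 2 * b = n ^+ 2 * (s * b) by ring.
by rewrite sb exprMn expr2; lra.
Qed.

(** [T^2 <= 2 b T], by [form_mul_le] with [G = T]. This converts smallness of [<T f, f>] into
    smallness of [T f]. *)
Lemma form_le_sqr T b f : form_symmetric T -> form_pos T -> 0 < b ->
  (forall f, cstar_pos (b%:C *: inner f f - inner (T f) f)) ->
  rnorm (T f) ^+ 2 <= 2 * b * rnorm (inner (T f) f).
Proof.
move=> sT pT b0 bT; have b2 : 0 < 2 * b by rewrite mulr_gt0.
rewrite rnorm_sqr -{1}(gtr0_norm b2) -rnormZ; apply: rnorm_le;
  first exact: inner_pos.
by rewrite -sT; exact: (form_mul_le sT pT sT (fun=> erefl) b2 (form_le_bounded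
  sT pT b0 bT)).
Qed.

Context (J : choiceType) (U : J -> H -> H) (b : R).
Hypothesis (sU : forall j, form_symmetric (U j)) (pU :
  forall j, form_pos (U j)).
Hypothesis b0 : 0 < b.
Let u f j := inner (U j f) f.
Hypothesis su : forall f, net_summable (u f).
Hypothesis bu : forall f, cstar_pos (b%:C *: inner f f - summability.sum (u f)).

Let UF (F : {fset J}) f := \sum_(j <- F) U j f.

Let sUF F : form_symmetric (UF F).
Proof.
move=> f g; rewrite inner_suml -inner_star inner_suml.
rewrite (big_morph (fun a : A => star a) (@starD R A) (@star0 R A)).
by apply: eq_bigr => j _; rewrite inner_star sU.
Qed.

Let pUF F : form_pos (UF F).
Proof. by move=> f; rewrite inner_suml; apply: cstar_pos_sum => j _;
  exact: pU. Qed.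

Let bUF F f : cstar_pos (b%:C *: inner f f - inner (UF F f) f).
Proof.
have := cstar_posD (bu f) (partial_sum_le F (fun j => pU j f) (@su f)).
by rewrite addrA subrK inner_suml.
Qed.

(** Each finite sum of the [U j] obeys the order bound [b], so by [form_le_sqr] the squared norm of
    a tail at [f] is at most [2 b] times the corresponding tail of [u f]. *)
Lemma frame_summable f : net_summable (U^~ f).
Proof.
apply: net_summable_cauchy => e e0.
have e'0 : 0 < e ^+ 2 / (2 * b) by rewrite divr_gt0 ?exprn_gt0 ?mulr_gt0.
have [F HF] := net_summable_tail (@su f) e'0; exists F => B FB.
have := HF B FB; rewrite ler_pdivlMr ?mulr_gt0 // mulrC -inner_suml => le.
have := le_trans (form_le_sqr f (sUF _) (pUF _) b0 (bUF _)) le.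
by rewrite ler_pXn2r // nnegrE ?rnorm_ge0 // ltW.
Qed.

Definition frame_op f := summability.sum (U^~ f).

Lemma inner_net_sum (x : J -> H) g : net_summable x ->
  forall e : R, 0 < e -> exists F, forall B, (F `<=` B)%fset ->
    rnorm (inner (summability.sum x) g - \sum_(j <- B) inner (x j) g) <= e.
Proof.
move=> sx e e0; have g1 : 0 < 2 * (rnorm g + 1).
  by rewrite mulr_gt0 // ltr_wpDl // rnorm_ge0.
have [|F HF] := net_summable_approx sx (e := e / (2 * (rnorm g + 1))).
  by rewrite divr_gt0.
exists F => B FB; rewrite -inner_suml -innerBl.
apply: le_trans (rnorm_inner _ _) _.
have := HF B FB; rewrite ler_pdivlMr //.
have := rnorm_ge0 g; have := rnorm_ge0 (summability.sum x - \sum_(j <- B) x j).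
by set n := rnorm _; nra.
Qed.

Lemma inner_frame_op f : inner (frame_op f) f = summability.sum (u f).
Proof. apply: net_sum_unique => //;
  exact: inner_net_sum f (@frame_summable f). Qed.

Lemma frame_op_symmetric : form_symmetric frame_op.
Proof.
move=> f g; apply: rnorm_approx_eq => e e0;
  have e2 : 0 < e / 2 by rewrite divr_gt0.
have [F HF] := inner_net_sum g (@frame_summable f) e2.
have [F' HF'] := inner_net_sum f (@frame_summable g) e2.
pose B := (F `|` F')%fset.
have := HF B (fsubsetUl _ _); have := HF' B (fsubsetUr _ _).
rewrite -!inner_suml -!/(UF _ _) -rnorm_star starB !inner_star -sUF.
have := rnormB (inner (frame_op f) g - inner (UF B f) g)
  (inner f (frame_op g) - inner (UF B f) g).
by rewrite opprB addrA subrK /frame_op; lra.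
Qed.

Lemma frame_op_pos : form_pos frame_op.
Proof. by move=> f; rewrite inner_frame_op; apply: net_sum_pos => // j;
  exact: pU. Qed.

Lemma frame_op_bounded : bounded_by frame_op (2 * b).
Proof.
apply: form_le_bounded b0 _; [exact: frame_op_symmetric|exact: frame_op_pos|].
by move=> f; rewrite inner_frame_op.
Qed.

End frame_operator.

(** * Operators bounded below *)

Section bounded_below.
Context (R : realType) (A : cstarAlgType R) (H : hilbertModType A).
Variables (S : H -> H) (M m : R).
Hypotheses (sS : form_symmetric S) (pS : form_pos S) (SM : bounded_by S M).
Hypotheses (M0 : 0 <= M) (m0 : 0 < m).
Hypothesis mS : forall f, m * rnorm f <= rnorm (S f).

Let shift (r : R) (f : H) := S f + r%:C *: f.

Let shiftB r f g : shift r f - shift r g = shift r (f - g).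
Proof. by rewrite /shift (form_symmetricB sS) opprD addrACA -scalerBr. Qed.

(** [(S + r)^2 - S^2 = 2 r S + r^2 >= 0], so the constant [m] is uniform in [r >= 0]. *)
Let shift_below r f : 0 <= r -> m * rnorm f <= rnorm (shift r f).
Proof.
move=> r0; apply: le_trans (mS f) _.
rewrite -(ler_pXn2r (n := 2)) ?nnegrE ?rnorm_ge0 // !rnorm_sqr.
apply: rnorm_le; first exact: inner_pos.
rewrite /shift innerDl !innerDr !inner_scale !inner_scaler !conjc_real -sS.
have -> : inner f (S f) = inner (S f) f by rewrite sS.
set a := inner (S (S f)) f; set b := r%:C *: inner (S f) f;
  set c := _ *: (_ *: inner f f).
have -> : a + b + (b + c) - a = b + (b + c) by rewrite addrC -addrA addKr.
apply: cstar_posD; last apply: cstar_posD; rewrite /b /c.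
- exact: cstar_posZ.
- exact: cstar_posZ.
- by apply: cstar_posZ => //; apply: cstar_posZ => //; exact: inner_pos.
Qed.

Let surjective_shift r := forall g, exists f, shift r f = g.

Let surjective_large r : M < r -> surjective_shift r.
Proof.
move=> Mr g; have r0 := le_lt_trans M0 Mr.
have q01 : 0 <= M / r < 1
  by rewrite divr_ge0 ?(ltW r0) //= ltr_pdivrMr // mul1r.
have [|f fE] := @contraction_fixpoint _ H (fun f => r^-1%:C *: (g - S f)) _ q01.
  move=> f h; rewrite -scalerBr opprD addrACA subrr add0r opprK addrC.
  rewrite -(form_symmetricB sS) rnormZ gtr0_norm ?invr_gt0 // mulrC mulrAC.
  rewrite ler_pM2r ?invr_gt0 // [rnorm (f - h)]rnorm_distC; exact: SM.
exists f; rewrite /shift {2}fE scalerA -rmorphM /= mulfV ?gt_eqF // scale1r.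
by rewrite addrC subrK.
Qed.

(* A contraction: the inverse of [S + (r + m/2)] has norm at most [1/m]. *)
Let surjective_step r : 0 <= r -> surjective_shift (r + m / 2) ->
  surjective_shift r.
Proof.
move=> r0 sur g.
have rm0 : 0 <= r + m / 2 by rewrite addr_ge0 // divr_ge0 // ltW.
have [D DE] := choice sur.
have q01 : 0 <= (2^-1 : R) < 1 by apply/andP; split; lra.
have [|f fE] := @contraction_fixpoint _ H (fun f => D (g + (m / 2)%:C *: f)) _
  q01.
  move=> f h; rewrite -(ler_pM2l m0).
  apply: le_trans (shift_below _ rm0) _; rewrite -shiftB !DE.
  rewrite opprD addrACA subrr add0r -scalerBr rnormZ gtr0_norm ?divr_gt0 //.
  by rewrite mulrA.
have := DE (g + (m / 2)%:C *: f); rewrite -fE /shift rmorphD scalerDl addrA.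
by move=> /addIr; exists f.
Qed.

(** Method of continuity: [S + r] is onto for [r > M], and finitely many steps of the fixed length
    [m / 2] bring [r] down to 0. *)
Lemma bounded_below_inverse :
  exists D, [/\ cancel S D, cancel D S & bounded_by D m^-1].
Proof.
have sur0 n : surjective_shift ((m / 2) *+ n) -> surjective_shift 0.
  elim: n => [//|n IH]; rewrite mulrSr => /surjective_step => sur.
  by apply: IH; apply: sur; rewrite mulrn_wge0 // divr_ge0 // ltW.
have [n Mn] : exists n, M < (m / 2) *+ n.
  have m2 : 0 < m / 2 by rewrite divr_gt0.
  exists (Num.truncn (M / (m / 2))).+1.
  by rewrite -mulr_natl -ltr_pdivrMr // truncnS_gt.
have [|D DE] := choice (sur0 n.+1 _).
  by apply: surjective_large; rewrite mulrSr ltr_wpDr // divr_ge0 // ltW.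
have DS : cancel D S by move=> f; have := DE f; rewrite /shift scale0r addr0.
have SD : cancel S D.
  move=> f; apply/subr0_eq/rnorm_eq0/le_anti; rewrite rnorm_ge0 andbT.
  by rewrite -(ler_pM2l m0) mulr0 (le_trans (mS _)) //
    (form_symmetricB sS) DS subrr rnorm0.
exists D; split => // f; rewrite mulrC ler_pdivlMr // mulrC.
by have := mS (D f); rewrite DS.
Qed.

End bounded_below.

Lemma uniform_boundedness (R : realType) (V W : completeNormedModType R[i])
    (F : set (V -> W)) :
  (forall T, F T -> linear T) ->
  (forall T, F T -> exists K : R, forall x, rnorm (T x) <= K * rnorm x) ->
  (forall x, exists K : R, forall T, F T -> rnorm (T x) <= K) ->
  exists K : R, forall T, F T -> forall x, rnorm x <= 1 -> rnorm (T x) <= K.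
Proof.
move=> linF bF pF.
suff /(_ 1) [K KF] : @uniform_bounded R (realified V) (realified W) F.
  by exists K => T FT x; exact: (KF T FT x).
apply: Banach_Steinhauss => [T FT|x].
- split; last by move=> r x y; have := linF T FT r%:C x y.
  have [K TK] := bF T FT; move=> r; exists (`|K| * r) => x xr.
  apply: le_trans (TK x) _; apply: le_trans (ler_wpM2l (normr_ge0 _) xr).
  by rewrite ler_wpM2r ?ler_norm // rnorm_ge0.
- have [K HK] := pF x; exists K => T FT; exact: HK.
Qed.

(** * Controlled g-frames *)

Section frame_terms.
Context (R : realType) (A : cstarAlgType R) (H : hilbertModType A).
Context (J : choiceType) (K : J -> hilbertModType A).
Variables (C C' : {linear H -> H}).
Hypotheses (hC : GLplus C) (hC' : GLplus C').
Hypothesis hCC' : forall f, C (C' f) = C' (C f).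

Lemma bounded_op_by (E F : hilbertModType A) (T : E -> F) : bounded_op T ->
  exists2 c : R, 0 < c & forall f, rnorm (T f) <= c * rnorm f.
Proof.
move=> [c cT]; exists (`|c| + 1); first by rewrite ltr_wpDl.
move=> f; have := cT f; rewrite !rnormE -rmorphM lecR => /le_trans; apply.
by rewrite ler_wpM2r ?rnorm_ge0 // ler_wpDr // ler_norm.
Qed.

Section one_family.
Variable L : forall j, adjointable H (K j).
Hypotheses (hCL : forall j f, C (adj (L j) (L j f)) = adj (L j) (L j (C f)))
  (hC'L : forall j f, C' (adj (L j) (L j f)) = adj (L j) (L j (C' f))).

Let G j f := adj (L j) (L j f).

Definition controlled_op j f := adj (L j) (L j (C (C' f))).

Lemma inner_adj j f g : inner (adj (L j) f) g = inner f (L j g).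
Proof. by rewrite -inner_star -adjP inner_star. Qed.

Let sG j : form_symmetric (G j).
Proof. by move=> f g; rewrite inner_adj adjP. Qed.

Let pG j : form_pos (G j).
Proof. by move=> f; rewrite inner_adj; exact: inner_pos. Qed.

Let cGC j : commuting (G j) C. Proof. by move=> f; rewrite /G hCL. Qed.

Let sC : form_symmetric C. Proof. by case: hC => _ _ /form_pos_symmetric. Qed.
Let sC' : form_symmetric C'. Proof.
  by case: hC' => _ _ /form_pos_symmetric. Qed.

Let sGC j : form_symmetric (G j \o C).
Proof. exact: form_symmetric_comp. Qed.

Let pGC j : form_pos (G j \o C).
Proof.
have [/bounded_op_by[c c0 Cc] _ pC] := hC.
exact: form_pos_mul (sG j) (pG j) sC pC (cGC j) c0 Cc.
Qed.

Let cGCC' j : commuting (G j \o C) C'.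
Proof. by move=> f /=; rewrite hCC' /G hC'L. Qed.

Lemma controlled_op_symmetric j : form_symmetric (controlled_op j).
Proof. exact: form_symmetric_comp (sGC j) sC' (cGCC' j). Qed.

Lemma controlled_op_pos j : form_pos (controlled_op j).
Proof.
have [/bounded_op_by[c c0 Cc] _ pC] := hC'.
exact: form_pos_mul (sGC j) (pGC j) sC' pC (cGCC' j) c0 Cc.
Qed.

Lemma controlled_termE f j :
  controlled_term C C' L f j = inner (controlled_op j f) f.
Proof. by rewrite /controlled_term -inner_adj -sC' -/(G j _) -(cGCC' j f). Qed.

Lemma controlled_term_pos f j : cstar_pos (controlled_term C C' L f j).
Proof. by rewrite controlled_termE; exact: controlled_op_pos. Qed.

(** Two uses of [form_mul_inverse_le] remove the controls: [G_j <= d G_j C] and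
    [G_j C <= d' G_j C C'], with [d] and [d'] bounding the inverses of [C] and [C']. *)
Lemma term_le_controlled : exists2 k : R, 0 < k & forall f j,
  cstar_pos (k%:C *: controlled_term C C' L f j - inner (L j f) (L j f)).
Proof.
have [/bounded_op_by[c c0 Cc] [D [CD DC /bounded_op_by[d d0 Dd]]] pC] := hC.
have [/bounded_op_by[c' c'0 Cc'] [D' [CD' DC' /bounded_op_by[d' d'0 Dd']]] pC']
  := hC'.
exists (d * d'); first exact: mulr_gt0.
move=> f j; rewrite controlled_termE -inner_adj.
have p1 := form_mul_inverse_le (sG j) (pG j) sC pC (cGC j) c0 Cc CD DC d0 Dd f.
have p2 := form_mul_inverse_le (sGC j) (@pGC j) sC' pC' (cGCC' j) c'0 Cc' CD'
  DC' d'0 Dd' f.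
have := cstar_posD (cstar_posZ (ltW d0) p2) p1.
by rewrite scalerBr scalerA -rmorphM addrA subrK.
Qed.

End one_family.

Lemma rnorm_sum_le (p u : J -> A) (k : R) (B : {fset J}) : 0 < k ->
  (forall j, cstar_pos (p j)) -> (forall j, cstar_pos (k%:C *: u j - p j)) ->
  rnorm (\sum_(j <- B) p j) <= k * rnorm (\sum_(j <- B) u j).
Proof.
move=> k0 pp pu; rewrite -{1}(gtr0_norm k0) -rnormZ; apply: rnorm_le.
  exact: cstar_pos_sum.
by rewrite scaler_sumr -sumrB; exact: cstar_pos_sum.
Qed.

(** * The cross operator of a summable family and a Bessel family *)

Section two_families.
Variables Gamma Lambda : forall j, adjointable H (K j).
Hypotheses
  (hCL : forall j f, C (adj (Lambda j) (Lambda j f)) = adj (Lambda j) (Lambda j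
    (C f)))
  (hC'L : forall j f, C' (adj (Lambda j) (Lambda j f)) = adj (Lambda j) (Lambda
    j (C' f)))
  (hCG : forall j f, C (adj (Gamma j) (Gamma j f)) = adj (Gamma j) (Gamma j (C
    f)))
  (hC'G : forall j f, C' (adj (Gamma j) (Gamma j f)) = adj (Gamma j) (Gamma j
    (C' f))).
Hypothesis hLambda : forall f, net_summable (controlled_term C C' Lambda f).
Hypothesis hGamma : controlled_gbessel C C' Gamma.

Let term f j := C' (adj (Gamma j) (Lambda j (C f))).

Let inner_term f j g :
  inner (term f j) g = inner (Lambda j (C f)) (Gamma j (C' g)).
Proof.
by case: hC' => _ _ /form_pos_symmetric sC'; rewrite sC' inner_adj.
Qed.

(** The uncontrolled sum is compared with the controlled one at [C' g], to which the Bessel bound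
    applies. The argument [C' g] is the one that [inner_term] produces. *)
Lemma rnorm_gbessel : exists2 k : R, 0 < k & forall (B : {fset J}) g,
  rnorm (\sum_(j <- B) inner (Gamma j (C' g)) (Gamma j (C' g))) <= k * rnorm g
    ^+ 2.
Proof.
have [b b0 hb] := hGamma.
have [k k0 hk] := term_le_controlled hCG hC'G.
have [/bounded_op_by[c c0 Cc] _ _] := hC'.
exists (k * (b * c ^+ 2)); first by rewrite !mulr_gt0 // exprn_gt0.
move=> B g.
have pu j : cstar_pos (controlled_term C C' Gamma (C' g) j).
  exact: controlled_term_pos.
have [su bu] := hb (C' g).
have le1 := rnorm_sum_le B k0 (fun j => inner_pos _) (hk (C' g)).
have le2 := rnorm_le (cstar_pos_sum B (fun j (_ :
  xpredT j) => pu j)) (partial_sum_le B pu su).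
have le3 := rnorm_le (net_sum_pos pu su) bu.
rewrite rnormZ gtr0_norm // -rnorm_sqr in le3.
have -> : k * (b * c ^+ 2) * rnorm g ^+ 2 = k * (b * (c * rnorm g) ^+ 2)
  by ring.
apply: le_trans le1 _; rewrite ler_pM2l //.
apply: le_trans le2 _; apply: le_trans le3 _; rewrite ler_pM2l //.
by rewrite ler_pXn2r // nnegrE ?rnorm_ge0 // mulr_ge0 ?rnorm_ge0 // ltW.
Qed.

(* The partial sums [y] satisfy
   [<y, y> = sum <Lambda_j C f, Gamma_j C' y>], which the Bessel bound on
   [Gamma] turns into a bound by [sum <Lambda_j C f, Lambda_j C f>]. *)
Lemma cross_summable f : net_summable (term f).
Proof.
have [k k0 hk] := rnorm_gbessel.
have [k' k'0 hk'] := term_le_controlled hCL hC'L.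
apply: net_summable_cauchy => e e0.
have d0 : 0 < e ^+ 2 / (4 * k * k') by rewrite divr_gt0 ?exprn_gt0 // !mulr_gt0.
have [F HF] := net_summable_tail (@hLambda (C f)) d0; exists F => B FB.
have {HF} := HF B FB; move: (B `\` F)%fset => D uD.
set y := \sum_(j <- D) _.
(* With this [s], testing against [s y] makes the Gamma part [k s^2 |y|^2] half of [s |y|^2], while
   the tolerance [d0] makes the Lambda part [s e^2 / 2]. *)
pose s := (2 * k)^-1; have s0 : 0 < s by rewrite invr_gt0 mulr_gt0.
have sk : s * k = 2^-1 by rewrite /s; field; rewrite gt_eqF.
have := rnorm_inner_sum D (fun j => Lambda j (C f)) (fun j => Gamma j (C' (s%:C
  *: y))).
have -> : \sum_(j <- D) inner (Lambda j (C f)) (Gamma j (C' (s%:C *: y))) =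
    s%:C *: inner y y.
  under eq_bigr do rewrite -inner_term.
  by rewrite -inner_suml inner_scaler conjc_real.
rewrite rnormZ gtr0_norm // -rnorm_sqr => /le_trans /(_ (rnormD _ _)).
have le1 := hk D (s%:C *: y); rewrite rnormZ gtr0_norm // in le1.
have le2 := rnorm_sum_le D k'0 (fun j => inner_pos _) (hk' (C f)).
have le3 := ler_wpM2l (ltW k'0) uD.
move=> le4.
have {le1 le2 le3 le4} :
  s * rnorm y ^+ 2 <= k' * (e ^+ 2 / (4 * k * k')) + k * (s * rnorm y) ^+ 2.
  by apply: le_trans le4 _; apply: lerD le1; apply: le_trans le2 le3.
have -> : k' * (e ^+ 2 / (4 * k * k')) = s * (e ^+ 2 / 2).
  by rewrite /s; field; rewrite !gt_eqF.
have -> : k * (s * rnorm y) ^+ 2 = s * (rnorm y ^+ 2 * (s * k)) by ring.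
rewrite -mulrDr ler_pM2l // sk => le5.
have : rnorm y ^+ 2 <= e ^+ 2 by lra.
by rewrite ler_pXn2r // nnegrE ?rnorm_ge0 // ltW.
Qed.

(* The functionals [<_, g>], for [g] with controlled sum at most 1 at [C' g], are
   bounded at each [L f] by Cauchy-Schwarz, hence uniformly. *)
Lemma rnorm_bounded_of_surjective :
  (forall g, exists f, controlled_cross_op C C' Gamma Lambda f = g) ->
  exists M : R, forall g,
    rnorm (summability.sum (controlled_term C C' Gamma (C' g))) <= 1 ->
      rnorm g <= M.
Proof.
move=> hsurj.
have [b b0 hb] := hGamma.
have [k k0 hk] := term_le_controlled hCG hC'G.
have [k' k'0 hk'] := term_le_controlled hCL hC'L.
pose small g := rnorm (summability.sum (controlled_term C C' Gamma (C' g))) <=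
  1.
pose F : set (H -> A) := [set inner^~ g | g in small].
have [T|T|f|M HM] := @uniform_boundedness R H A F.
- by move=> [g _ <-] r x y; rewrite innerDl inner_scale.
- move=> [g _ <-]; exists (2 * rnorm g) => x; rewrite -mulrA [rnorm g * _]mulrC.
  exact: rnorm_inner.
- have [f' <-] := hsurj f.
  (* The three summands are the Lambda part of Cauchy-Schwarz, the Gamma part with its controlled
     sum at most 1, and the error of replacing the series by a finite sum. *)
  exists (k' * rnorm (summability.sum (controlled_term C C' Lambda (C f'))) + k
    + 1).
  move=> _ [g sg <-].
  have [B HB] := inner_net_sum g (@cross_summable f') ltr01.
  have {HB} := HB B (fsubset_refl B);
    rewrite -/(controlled_cross_op C C' Gamma Lambda f').
  under eq_bigr do rewrite inner_term.
  have := rnorm_inner_sum B (fun j => Lambda j (C f')) (fun j => Gamma j (C'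
    g)).
  move=> /le_trans /(_ (rnormD _ _)).
  have le1 := rnorm_sum_le B k'0 (fun j => inner_pos _) (hk' (C f')).
  have le2 := rnorm_sum_le B k0 (fun j => inner_pos _) (hk (C' g)).
  have pu1 j := controlled_term_pos hCL hC'L (C f') j.
  have pu2 j := controlled_term_pos hCG hC'G (C' g) j.
  have le3 := rnorm_le (cstar_pos_sum B (fun j (_ : xpredT j) => pu1 j))
    (partial_sum_le B pu1 (@hLambda (C f'))).
  have le4 := rnorm_le (cstar_pos_sum B (fun j (_ : xpredT j) => pu2 j))
    (partial_sum_le B pu2 (hb (C' g)).1).
  have {}le3 := ler_wpM2l (ltW k'0) le3.
  have {}le4 := ler_wpM2l (ltW k0) (le_trans le4 sg).
  set x := inner _ g; set y := \sum_(j <- B) _ => le5 le6.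
  have := rnormD (x - y) y; rewrite subrK.
  by move: le1 le2 le3 le4 le5 le6; rewrite mulr1 /y; lra.
(* The absolute value provides a nonnegative bound for [g = 0]. Otherwise the functional is
   evaluated at the unit vector [g / |g|], where its norm is [|g|]. *)
exists (`|M|) => g sg.
have := rnorm_ge0 g; rewrite le_eqVlt => /orP[/eqP <- //|g0].
have := HM (inner^~ g) (ex_intro2 _ _ g sg erefl) ((rnorm g)^-1%:C *: g).
rewrite inner_scale !rnormZ gtr0_norm ?invr_gt0 // mulVf ?gt_eqF //
  lexx => /(_ isT).
by rewrite -rnorm_sqr expr2 mulKf ?gt_eqF // => /le_trans; apply;
  exact: ler_norm.
Qed.

End two_families.
End frame_terms.

Theorem theorem3p5 (R : realType) (A : cstarAlgType R) (H : hilbertModType A)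
    (J : choiceType) (Hj : J -> closedSubmod H)
    (C C' : {linear H -> H}) (hC : GLplus C) (hC' : GLplus C')
    (Lambda Gamma : forall j : J, adjointable H (submod (Hj j)))
    (hLambda : controlled_gframe C C' Lambda)
    (hGamma : controlled_gbessel C C' Gamma)
    (hCC' : forall f : H, C (C' f) = C' (C f))
    (hCL : forall j f,
      C (adj (Lambda j) (Lambda j f)) = adj (Lambda j) (Lambda j (C f)))
    (hC'L : forall j f,
      C' (adj (Lambda j) (Lambda j f)) = adj (Lambda j) (Lambda j (C' f)))
    (hCG : forall j f,
      C (adj (Gamma j) (Gamma j f)) = adj (Gamma j) (Gamma j (C f)))
    (hC'G : forall j f,
      C' (adj (Gamma j) (Gamma j f)) = adj (Gamma j) (Gamma j (C' f)))
    (hsurj : forall g, exists f, controlled_cross_op C C' Gamma Lambda f = g) :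
  controlled_gframe C C' Gamma.
Proof.
have hL f : net_summable (controlled_term C C' Lambda f).
  by have [a [b [_ /(_ f)[]]]] := hLambda.
have [b b0 hb] := hGamma.
have [M HM] := rnorm_bounded_of_surjective hC hC' hCC' hCL hC'L hCG hC'G hL
  hGamma hsurj.
pose U := controlled_op C C' Gamma.
have sU j : form_symmetric (U j) by exact: controlled_op_symmetric.
have pU j : form_pos (U j) by exact: controlled_op_pos.
have termE f : controlled_term C C' Gamma f = fun j => inner (U j f) f.
  by apply/funext => j; exact: controlled_termE.
have su f : net_summable (fun j => inner (U j f) f).
  by rewrite -termE; exact: (hb f).1.
have bu f : cstar_pos (b%:C *: inner f f - summability.sum (fun j => inner (U j
  f) f)).
  by rewrite -termE; exact: (hb f).2.
pose S := frame_op U.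
have sS : form_symmetric S by exact: frame_op_symmetric sU pU b0 su bu.
have pS : form_pos S by exact: frame_op_pos sU pU b0 su bu.
have bS : bounded_by S (2 * b) by exact: frame_op_bounded sU pU b0 su bu.
have SE f : inner (S f) f = summability.sum (controlled_term C C' Gamma f).
  by rewrite termE; exact: inner_frame_op sU pU b0 su bu f.
have [/bounded_op_by[c c0 Cc] [D' [CD' DC' _]] _] := hC'.
(* [HM] is applied to [D' k], the preimage of [k] under [C']; going back costs the bound [c] of
   [C']. *)
have small k : rnorm (inner (S k) k) <= 1 -> rnorm k <= c * M.
  rewrite SE -[k]DC' => /HM le; apply: le_trans (Cc _) _.
  by rewrite ler_pM2l.
(* A vector [t k] of norm [N > c M] violates [small], so Cauchy-Schwarz gives
   [1 < 2 N |S (t k)| = 2 N^2 |S k| / |k|]; hence the value of [m]. *)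
pose N := `|c * M| + 1; have N0 : 0 < N by rewrite ltr_wpDl.
pose m := (2 * N ^+ 2)^-1;
  have m0 : 0 < m by rewrite invr_gt0 mulr_gt0 // exprn_gt0.
have mS k : m * rnorm k <= rnorm (S k).
  have := rnorm_ge0 k; rewrite le_eqVlt => /orP[/eqP <-|k0].
    by rewrite mulr0 rnorm_ge0.
  pose t := N / rnorm k; have t0 : 0 < t by rewrite divr_gt0.
  have tk : rnorm (t%:C *: k) = N by rewrite rnormZ gtr0_norm // divfK ?gt_eqF.
  have : 1 < rnorm (inner (S (t%:C *: k)) (t%:C *: k)).
    rewrite ltNge; apply/negP => /small; rewrite tk /N.
    by have := ler_norm (c * M); lra.
  move=> /lt_le_trans /(_ (rnorm_inner _ _)).
  rewrite tk (form_symmetricZ _ sS) rnormZ gtr0_norm // => lt1.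
  have e : 2 * (t * rnorm (S k) * N) = rnorm (S k) / (m * rnorm k).
    by rewrite /t /m; field; rewrite !gt_eqF.
  by move: lt1; rewrite e ltr_pdivlMr ?mulr_gt0 // mul1r => /ltW.
have b2 : 0 < 2 * b by rewrite mulr_gt0.
have [D [SD DS Dm]] := bounded_below_inverse sS pS bS (ltW b2) m0 mS.
have mi0 : 0 < m^-1 by rewrite invr_gt0.
have lower f : cstar_pos (summability.sum (controlled_term C C' Gamma f) - m%:C
  *: inner f f).
  (* With [G] the identity, boundedness of [D = S^-1] by [m^-1] becomes the order inequality
     [<f, f> <= m^-1 <S f, f>]. *)
  have := form_mul_inverse_le (G := id) (fun _ _ => erefl) (@inner_pos R A H)
    sS pS (fun=> erefl) b2 bS SD DS mi0 Dm f.
  move=> /(cstar_posZ (ltW m0)); rewrite scalerBr scalerA -rmorphM /=.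
  by rewrite mulfV ?gt_eqF // scale1r SE.
(* The minimum secures the required order of the two frame constants; lowering [m] is harmless
   because [<f, f>] is positive. *)
exists (Num.min m b), b; split; first by rewrite lt_min m0 b0 ge_min lexx orbT.
move=> f; have [sf bf] := hb f; split => //; rewrite /cstar_le.
have mb : 0 <= m - Num.min m b by rewrite subr_ge0 ge_min lexx.
have := cstar_posD (lower f) (cstar_posZ mb (inner_pos f)).
by rewrite rmorphB scalerBl addrA subrK.
Qed.
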